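(* Let $k,n,m\ge 1$ be integers, let $\Omega\subseteq\mathbb{C}$ be open, and let $A_0,E_1,\dots,E_k$ be $n\times n$ complex matrices. Assume that $A(x)=A_0+\sum_{i=1}^k x_iE_i\in M_n(\Omega,m)$ for all $x=(x_1,\dots,x_k)$ in some neighborhood of $x=0$ in $\mathbb{R}^k$, and let $f$ be $(k+1)m-1$ times continuously differentiable on $\Omega$. Then the $k$th Fréchet derivative $L_f^{(k)}(A_0,E_1,\dots,E_k)$ exists, is continuous in $A_0$ and $E_1,\dots,E_k$, and is given by the upper right $n\times n$ block of $f(X_k(x))|_{x=0}$, where $$X_0(x)=A(x),\qquad X_i(x)=\begin{bmatrix} X_{i-1}(x) & \frac{\partial}{\partial x_i}X_{i-1}(x)\\ 0 & X_{i-1}(x)\end{bmatrix},\quad i=1,\dots,k.$$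
   Context: For an open set $\Omega\subseteq\mathbb{C}$, $M_n(\Omega,m)$ denotes the set of $n\times n$ complex matrices whose spectrum is contained in $\Omega$ and whose largest Jordan block has size at most $m$. For a scalar function $f:\Omega\to\mathbb{C}$ (differentiability on $\Omega$ is with respect to the complex variable), $f(A)$ denotes the matrix function in the standard sense, defined through the Jordan canonical form (equivalently Hermite interpolation) of $A$. The Fréchet derivative $L_f(A,E)=L_f^{(1)}(A,E)$ is the unique mapping, linear in $E$, with $L_f(A,E)=f(A+E)-f(A)+o(\|E\|)$. For $j>1$, the $j$th Fréchet derivative $L_f^{(j)}(A_0,E_1,\dots,E_j)$ is the mapping, linear in each of $E_1,\dots,E_j$, that satisfies $$L_f^{(j)}(A_0,E_1,\dots,E_j)=L_f^{(j-1)}(A_0+E_j,E_1,\dots,E_{j-1})-L_f^{(j-1)}(A_0,E_1,\dots,E_{j-1})+o(\|E_j\|).$$ *)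

(* Defs.v *)
From HB Require Import structures.
From mathcomp Require Import all_boot all_order all_algebra.
From mathcomp Require Import complex.
From mathcomp Require Import all_classical reals topology normedtype landau derive.

Set Implicit Arguments.
Unset Strict Implicit.
Unset Printing Implicit Defensive.

Import Order.TTheory GRing.Theory Num.Theory.
Import numFieldNormedType.Exports.

Local Open Scope classical_set_scope.
Local Open Scope ring_scope.

(* Typing [R[i]] as a [numClosedFieldType] gives it, and matrices over it, the
   topology and norm that MathComp-Analysis attaches to any [numFieldType];
   derivatives over [Cplx R] are then derivatives in the complex variable. *)
Definition Cplx (R : realType) : numClosedFieldType := R[i]%C.

Definition cplx_of_real (R : realType) (t : R) : Cplx R := t%:C%C.

Section SmoothFunctions.
Context {R : realType}.
Implicit Types (f : Cplx R -> Cplx R) (Omega : set (Cplx R)) (z : Cplx R).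

(* [derive1n] is total: its values are derivatives only under this predicate. *)
Fixpoint times_derivable (j : nat) f z : Prop :=
  if j is i.+1 then
    (\forall w \near z, times_derivable i f w) /\ derivable (derive1n i f) z 1
  else True.

(* For open [Omega]; [f] is total, but only its values on [Omega] matter. *)
Definition times_cont_diff_on (N : nat) f Omega : Prop :=
  (forall j z, (j < N)%N -> Omega z -> derivable (derive1n j f) z 1) /\
  (forall z, Omega z -> {for z, continuous (derive1n N f)}).

End SmoothFunctions.

Section MatrixFunctions.
Context {R : realType}.
Implicit Types (f : Cplx R -> Cplx R).

Definition jordan_block (s : nat) (a : Cplx R) : 'M[Cplx R]_s :=
  \matrix_(i, j) (if i == j then a else if i.+1 == j then 1 else 0).

Definition fun_jordan_block f (s : nat) (a : Cplx R) : 'M[Cplx R]_s :=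
  \matrix_(i, j)
    (if (i <= j)%N then derive1n (j - i) f a / ((j - i)`!)%:R else 0).

(* A = Z J Z^-1; [Z] and its inverse are kept as two rectangular-typed matrices
   so that [n] need only be propositionally equal to the sum of block sizes. *)
Record jordan_decomp (n : nat) (A : 'M[Cplx R]_n) := JordanDecomp {
  jd_num : nat;
  jd_size : 'I_jd_num -> nat;
  jd_eig : 'I_jd_num -> Cplx R;
  jd_Z : 'M[Cplx R]_(n, \sum_l jd_size l);
  jd_Zinv : 'M[Cplx R]_(\sum_l jd_size l, n);
  jd_size_gt0 : forall l, (0 < jd_size l)%N;
  jd_ZK : jd_Z *m jd_Zinv = 1%:M;
  jd_KZ : jd_Zinv *m jd_Z = 1%:M;
  jd_eq : A = jd_Z *m (\mxdiag_l jordan_block (jd_size l) (jd_eig l))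
                   *m jd_Zinv
}.
Arguments jd_size {n A} _ _.
Arguments jd_eig {n A} _ _.

(* M_n(Omega, m) *)
Definition spectrum_block_in (n : nat) (Omega : set (Cplx R)) (m : nat)
    : set 'M[Cplx R]_n :=
  [set A | (forall a, eigenvalue A a -> Omega a) /\
           exists D : jordan_decomp A, forall l, (jd_size D l <= m)%N].

(* The values f(A) = Z f(J) Z^-1, when f is defined on the spectrum of A. *)
Definition is_matfun (n : nat) f (A : 'M[Cplx R]_n) : set 'M[Cplx R]_n :=
  [set B | exists D : jordan_decomp A,
     (forall l, times_derivable (jd_size D l).-1 f (jd_eig D l)) /\
     B = jd_Z D *m (\mxdiag_l fun_jordan_block f (jd_size D l) (jd_eig D l))
                *m jd_Zinv D].

Definition matfun_defined (n : nat) f (A : 'M[Cplx R]_n) : Prop :=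
  exists B, is_matfun f A B.

(* Does not depend on the Jordan decomposition; 0 if f(A) is undefined. *)
Definition matfun (n : nat) f (A : 'M[Cplx R]_n) : 'M[Cplx R]_n :=
  xget 0 (is_matfun f A).

End MatrixFunctions.
Arguments jd_size {R n A} _ _.
Arguments jd_eig {R n A} _ _.

Section Frechet.
Context {R : realType} {n : nat}.
Implicit Types (f : Cplx R -> Cplx R).

(* L_f^(j)(A, E_1, .., E_j), with E_i written [E (i-1)]: the differential at [A]
   of [B |-> L_f^(j-1)(B, E_1, .., E_(j-1))], applied to E_j.  Linearity in E_j
   is that of ['d]; linearity in the other directions follows by induction. *)
Fixpoint frechet f (j : nat)
    : 'M[Cplx R]_n -> ('I_j -> 'M[Cplx R]_n) -> 'M[Cplx R]_n :=
  match j with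
  | 0 => fun A _ => matfun f A
  | i.+1 => fun A E =>
      'd (fun B => @frechet f i B (fun l : 'I_i => E (widen_ord (leqnSn i) l))) A
         (E ord_max)
  end.

Fixpoint frechet_exists f (j : nat) (A : 'M[Cplx R]_n) : Prop :=
  if j is i.+1 then
    (\forall B \near A, frechet_exists f i B) /\
    (forall E : 'I_i -> 'M[Cplx R]_n,
       differentiable (fun B => frechet f B E) A)
  else matfun_defined f A.

End Frechet.
Arguments frechet {R n} f j _ _.

Section BlockMatrices.
Context {R : realType} {k n : nat}.

Definition affine_pencil (A0 : 'M[Cplx R]_n) (E : 'I_k -> 'M[Cplx R]_n)
    (x : 'rV[R]_k) : 'M[Cplx R]_n :=
  A0 + \sum_(i < k) cplx_of_real (x 0 i) *: E i.

(* Partial derivative in the real variable of index [i] (counted from 0).  The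
   library's ['D_v] does not apply: it wants source and target over one field. *)
Definition partial (d i : nat) (X : 'rV[R]_k -> 'M[Cplx R]_d) (x : 'rV[R]_k)
    : 'M[Cplx R]_d :=
  let e : 'rV[R]_k := \row_l (l == i :> nat)%:R in
  lim ((fun t : R => cplx_of_real t^-1 *: (X (t *: e + x) - X x)) @ 0^').

(* 2 ^ i * n, in the form that [block_mx] produces. *)
Fixpoint block_dim (d i : nat) : nat :=
  if i is j.+1 then (block_dim d j + block_dim d j)%N else d.

Fixpoint block_X (A : 'rV[R]_k -> 'M[Cplx R]_n) (i : nat)
    : 'rV[R]_k -> 'M[Cplx R]_(block_dim n i) :=
  match i with
  | 0 => A
  | j.+1 => fun x =>
      block_mx (block_X A j x) (partial j (block_X A j) x)
               0               (block_X A j x)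
  end.

End BlockMatrices.

Fixpoint upper_right (T : Type) (n i : nat)
    : 'M[T]_(block_dim n i) -> 'M[T]_n :=
  match i with
  | 0 => fun Y => Y
  | j.+1 => fun Y => @upper_right T n j (ursubmx Y)
  end.
Arguments upper_right {T} n i Y.

(* Main.v *)
(** [f] is C^1 in the complex variable, hence analytic: Cauchy's formula follows
    by a homotopy of circles, with contour integrals replaced by limits of
    averages over roots of unity.  Thus all divided differences of [f] are
    holomorphic and bounded near the spectrum, and [f(A) = N(A)] for the Newton
    interpolation polynomial [N] of [f] at the roots of the characteristic
    polynomial, which bounds [f] locally on matrices of every size.

    The corner of [f([[B, E], [0, A]])] is linear in [E], and it equals
    [f(B) - f(A)] when [E = B - A].  Local boundedness of [f] at size [2n]
    therefore gives continuity at size [n]; continuity at size [2n] then makes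
    [f] differentiable at size [n], with [L_f(A, E)] the corner of
    [f([[A, E], [0, A]])].  By induction [L_f^(i)(A, E_1, .., E_i)] is the corner
    of [f(X_i)], where [X_i] is affine in [A], so differentiating it once more
    only needs the first-order result at size [2^i n]. *)

Require Import Defs.
From HB Require Import structures.
From mathcomp Require Import all_boot all_order all_algebra.
From mathcomp Require Import complex ring.
From mathcomp Require Import all_classical reals topology normedtype landau derive.

Set Implicit Arguments.
Unset Strict Implicit.
Unset Printing Implicit Defensive.

Import Order.TTheory GRing.Theory Num.Theory.
Import numFieldNormedType.Exports.

Local Open Scope classical_set_scope.
Local Open Scope ring_scope.

(** * Jordan decomposition *)

Section JordanForm.

(** Defining [matfun] through Jordan forms raises two obstacles. A value must exist and be the same
    for every decomposition: [f] minus its Newton polynomial is [q] times a holomorphic function,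
    where [q] annihilates [A]. Hence [q] vanishes at each eigenvalue to the order of every block
    there, and no decomposition can tell [f] from the polynomial. Moreover, Jordan forms jump when
    eigenvalues collide, so no estimate can be made on them. The Newton form survives collisions:
    Cauchy's formula bounds divided differences without any lower bound on the distance between
    nodes. The resulting constants depend only on the size, a bound for entries and nodes, and a
    fixed neighbourhood of the spectrum, so the nodes may follow the eigenvalues of a varying matrix
    in any order. *)

Lemma sum_jordan_row (C : pzSemiRingType) m (a : C) (x : nat -> C) (i : 'I_m) :
  x m = 0 ->
  \sum_(l < m) (if i == l then a else if i.+1 == l then 1 else 0) * x l
    = a * x i + x i.+1.
Proof.
move=> xm; rewrite (bigD1 i) //= eqxx; congr (_ + _).
have [lt_im|ge_im] := ltnP i.+1 m; last first.
  rewrite (_ : i.+1 = m) ?xm; last by apply/eqP; rewrite eqn_leq ge_im ltn_ord.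
  rewrite big1 // => l /negPf nli; rewrite eq_sym nli ifN ?mul0r //.
  by rewrite neq_ltn ltn_ord orbT.
rewrite (bigD1 (Ordinal lt_im)) /=; last by rewrite -val_eqE /= gtn_eqF.
rewrite -val_eqE /= ltn_eqF // eqxx mul1r big1 ?addr0 // => l /andP[nli].
by rewrite -val_eqE /= eq_sym => /negPf nl; rewrite eq_sym (negPf nli) nl mul0r.
Qed.

Lemma sum_jordan_col (C : pzSemiRingType) m (a : C) (x : nat -> C) (j : 'I_m) :
  \sum_(l < m) x l * (if l == j then a else if l.+1 == j then 1 else 0)
    = x j * a + (if j : nat is j'.+1 then x j' else 0).
Proof.
rewrite (bigD1 j) //= eqxx; congr (_ + _).
case: j => -[|j] lt_jm /=.
  by apply: big1 => l /negPf ->; rewrite mulr0.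
rewrite (bigD1 (Ordinal (ltnW lt_jm))) /=; last by rewrite -val_eqE /= ltn_eqF.
rewrite -val_eqE /= ltn_eqF // eqxx mulr1 big1 ?addr0 // => l /andP[/negPf->].
by rewrite -val_eqE /= -eqSS => /negPf ->; rewrite mulr0.
Qed.

(* With [p = (X - a)^(s+1) q] the minimal polynomial of [A], [N = A - a] and
   [Q = q(A)], some entry (i, j) of [Q N^s Q] is nonzero.  The chain
   [(e_i Q) N^l] spans a Jordan block, and the common kernel of the functionals
   [N^l Q e_j] is an invariant complement of it. *)
Lemma cyclic_splitting (C : closedFieldType) n (A : 'M[C]_n.+1) :
  exists (a : C) (s d : nat) (P : 'M[C]_(s.+1 + d, n.+1))
         (P' : 'M[C]_(n.+1, s.+1 + d)) (B : 'M[C]_d),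
  [/\ P *m P' = 1%:M, P' *m P = 1%:M &
      P *m A = block_mx (\matrix_(i, j) (if i == j then a else
                           if i.+1 == j then 1 else 0)) 0 0 B *m P].
Proof.
have [a ra] : exists a, root (mxminpoly A) a.
  apply/closed_rootP; rewrite size_mxminpoly eqSS -lt0n.
  exact: mxminpoly_nonconstant.
have p_neq0 : mxminpoly A != 0 by rewrite monic_neq0 ?mxminpoly_monic.
have [m [q]] := multiplicity_XsubC (mxminpoly A) a; rewrite p_neq0 /= => nqa Dp.
case: m Dp => [|s] Dp; first by rewrite Dp expr0 mulr1 (negPf nqa) in ra.
pose J : 'M[C]_s.+1 := \matrix_(l, k) (if l == k then a else
  if l.+1 == k then 1 else 0).
pose N : 'M[C]_n.+1 := A - a%:M; pose Q := horner_mx A q.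
have NE k : N ^+ k = horner_mx A (('X - a%:P) ^+ k).
  by rewrite rmorphXn rmorphB /= horner_mx_X horner_mx_C.
have AE : A = N + a%:M by rewrite subrK.
have QN0 k : (s < k)%N -> Q * N ^+ k = 0.
  move=> /subnK <-; rewrite addnC exprD mulrA (NE s.+1) -rmorphM -Dp.
  by rewrite [X in X * _]mx_root_minpoly mul0r.
have NQ k : N ^+ k * Q = Q * N ^+ k by rewrite NE -!rmorphM mulrC.
(* If [Q N^s Q] were 0, the minimal polynomial would divide [q (X - a)^s q]; cancelling
   [q (X - a)^s] leaves [X - a] dividing [q], against the choice of the multiplicity. *)
have [i [j nzij]] : exists i j, (Q * N ^+ s * Q) i j != 0.
  apply: contrapT => /forallNP Q0.
  have : horner_mx A (q * ('X - a%:P) ^+ s * q) = 0.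
    apply/matrixP => i j; rewrite !rmorphM /= -NE [RHS]mxE.
    by have /forallNP /(_ j) /negP := Q0 i; rewrite negbK => /eqP.
  move/mxminpoly_min; rewrite Dp exprSr mulrA dvdp_mul2l.
    by rewrite dvdp_XsubCl (negPf nqa).
  by move: p_neq0; rewrite Dp exprSr mulrA mulf_eq0 negb_or => /andP[].
pose U : 'M[C]_(s.+1, n.+1) := \matrix_(l, k) (Q * N ^+ l) i k.
pose W : 'M[C]_(n.+1, s.+1) := \matrix_(k, l) (N ^+ (s - l) * Q) k j.
have UA : U *m A = J *m U.
  apply/matrixP => l k; rewrite !mxE.
  transitivity (a * (Q * N ^+ l) i k + (Q * N ^+ l.+1) i k); last first.
    rewrite -(sum_jordan_row a (x := fun l => (Q * N ^+ l) i k)); last first.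
      by rewrite QN0 // mxE.
    by apply: eq_bigr => h _; rewrite !mxE.
  transitivity ((Q * N ^+ l * A) i k).
    by rewrite [in RHS]mxE; apply: eq_bigr => h _; rewrite mxE.
  rewrite {1}AE mulrDr addrC -[_ * N]mulrA -exprSr mxE; congr (_ + _).
  by rewrite [_ * a%:M]mul_mx_scalar mxE.
have AW : A *m W = W *m J.
  apply/matrixP => k l; rewrite !mxE.
  transitivity ((N ^+ (s - l) * Q) k j * a +
      (if l : nat is l'.+1 then (N ^+ (s - l') * Q) k j else 0)); last first.
    rewrite -(sum_jordan_col a (fun l => (N ^+ (s - l) * Q) k j)).
    by apply: eq_bigr => h _; rewrite !mxE.
  transitivity ((A * (N ^+ (s - l) * Q)) k j).
    by rewrite [in RHS]mxE; apply: eq_bigr => h _; rewrite mxE.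
  rewrite {1}AE mulrDl addrC [N * _]mulrA -exprS mxE; congr (_ + _).
    by rewrite [a%:M * _]mul_scalar_mx mxE mulrC.
  case: l => -[|l] lt_l /=; first by rewrite subn0 NQ QN0 // mxE.
  by rewrite subnSK.
pose G := U *m W.
have GE l l' : G l l' = (Q * N ^+ (l + (s - l')) * Q) i j.
  rewrite exprD mulrA -mulrA [in RHS]mxE mxE; apply: eq_bigr => h _.
  by rewrite !mxE.
(* [G] is upper triangular: below the diagonal the exponent of [N] exceeds [s]. All its diagonal
   entries equal the nonzero entry (i, j). *)
have uG : G \in unitmx.
  rewrite -unitmx_tr unitmxE det_trig; last first.
    apply/is_trig_mxP => l l' lt_ll'; rewrite mxE GE QN0 ?mul0r ?mxE //.
    by rewrite addnBA ?leq_ord // ltn_subRL ltn_add2r.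
  rewrite unitfE; apply/prodf_neq0 => l _; rewrite mxE GE.
  by rewrite subnKC ?leq_ord.
pose K := row_base (kermx W).
have KW : K *m W = 0.
  by apply: sub_kermxP; rewrite /K eq_row_base.
have [K0 KK0] : exists K0, K *m K0 = 1%:M.
  by apply/row_freeP; exact: row_base_free.
have kerK m' (X : 'M[C]_(m', n.+1)) : X *m W = 0 -> exists Y, X = Y *m K.
  by move=> /sub_kermxP XW; apply/submxP; rewrite /K eq_row_base.
have [B KA] : exists B, K *m A = B *m K.
  by apply: kerK; rewrite -mulmxA AW mulmxA KW mul0mx.
(* [H] projects row vectors onto the kernel of [W] along the span of the rows of [U]. *)
pose H := 1%:M - W *m invmx G *m U.
have UH : U *m H = 0.
  by rewrite mulmxBr mulmx1 !mulmxA -/G mulmxV // mul1mx subrr.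
have KH : K *m H = K.
  by rewrite mulmxBr mulmx1 !mulmxA KW !mul0mx subr0.
have [Y HY] : exists Y, H = Y *m K.
  by apply: kerK; rewrite mulmxBl mul1mx -!mulmxA -/G mulVmx // mulmx1 subrr.
exists a, s, (\rank (kermx W)), (col_mx U K), (row_mx (W *m invmx G) (H *m K0)), B.
split.
- rewrite mul_col_row !mulmxA UH KH KW KK0 !mul0mx -/G mulmxV //.
  by rewrite -scalar_mx_block.
- rewrite mul_row_col HY -(mulmxA Y) KK0 mulmx1 -HY.
  by rewrite /H addrC subrK.
- by rewrite mul_col_mx mul_block_col !mul0mx addr0 add0r UA KA.
Qed.

End JordanForm.

Section JordanExistence.
Variable R : realType.

(** Splitting off a block produces the size [p0 + \sum p], only propositionally equal to the sum
    over all blocks; the cast is confined to this lemma. *)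
Lemma jordan_decomp_castmx n m (p : 'I_m -> nat) (e : 'I_m -> Cplx R)
    (A : 'M[Cplx R]_n) N (E : N = (\sum_l p l)%N) (J : 'M_N)
    (Z : 'M_(n, N)) (Z' : 'M_(N, n)) :
  (forall l, (0 < p l)%N) -> Z *m Z' = 1%:M -> Z' *m Z = 1%:M ->
  \mxdiag_l jordan_block (p l) (e l) = castmx (E, E) J ->
  A = Z *m J *m Z' -> inhabited (jordan_decomp A).
Proof.
move=> p_gt0 ZK KZ JE AE; subst N; rewrite castmx_id in JE.
by constructor; apply: (@JordanDecomp R n A m p e Z Z') => //; rewrite AE JE.
Qed.

Lemma jordan_decomp_exists n (A : 'M[Cplx R]_n) : inhabited (jordan_decomp A).
Proof.
have [N] := ubnP n; elim: N => // N IH in n A *.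
case: n A => [A _|n A lt_nN].
  have E : 0%N = (\sum_(l < 0) 1)%N by rewrite big_ord0.
  apply: (@jordan_decomp_castmx 0 0 (fun=> 1%N) (fun=> 0) A 0%N E 0 0 0) => //.
  - by rewrite [LHS]flatmx0 [RHS]flatmx0.
  - by rewrite [LHS]flatmx0 [RHS]flatmx0.
  - by apply/matrixP => -[i lt_i]; exfalso; rewrite -E in lt_i.
  - by rewrite [LHS]flatmx0 [RHS]flatmx0.
have [a [s [d [P [P' [B [PK KP PA]]]]]]] := cyclic_splitting A.
have lt_dN : (d < N)%N.
  rewrite -ltnS; apply: leq_trans lt_nN; rewrite ltnS.
  by apply: leq_trans (mulmx1_min PK); rewrite addSn ltnS leq_addl.
have [[m p e Z Z' p_gt0 ZK KZ BE]] := IH _ B lt_dN.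
pose p1 (l : 'I_m.+1) := if unlift ord0 l is Some l' then p l' else s.+1.
pose e1 (l : 'I_m.+1) := if unlift ord0 l is Some l' then e l' else a.
have p1_gt0 l : (0 < p1 l)%N by rewrite /p1; case: unliftP.
have p1S : p = fun l => p1 (lift ord0 l).
  by apply: funext => l; rewrite /p1 liftK.
have e1S : e = fun l => e1 (lift ord0 l).
  by apply: funext => l; rewrite /e1 liftK.
have p10 : s.+1 = p1 ord0 by rewrite /p1 unlift_none.
have e10 : a = e1 ord0 by rewrite /e1 unlift_none.
change (\matrix_(_, _) _) with (jordan_block s.+1 a) in PA.
(* The sizes must become literally [p1 ord0] and [p1 (lift ord0 l)], the shape of [mxdiag_recl]; all
   matrices typed with the old sizes are generalized before the substitution. *)
clearbody p1 e1; move: P P' PK KP PA Z Z' ZK KZ BE {IH p_gt0}.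
rewrite e10 {a e10}; move: (s.+1) p10 => {}s p10; subst s p e => P P' PK KP PA Z Z' ZK KZ BE.
apply: (@jordan_decomp_castmx _ _ p1 e1 A _ (@mxsize_recl _ p1)
  (block_mx (jordan_block (p1 ord0) (e1 ord0)) 0 0
         (\mxdiag_l jordan_block (p1 (lift ord0 l)) (e1 (lift ord0 l))))
   (P' *m block_mx 1%:M 0 0 Z) (block_mx 1%:M 0 0 Z' *m P)) => //.
- rewrite mulmxA -(mulmxA P') mulmx_block !(mulmx0, mul0mx, addr0, add0r) mulmx1 ZK.
  by rewrite -scalar_mx_block mulmx1.
- rewrite mulmxA -(mulmxA _ P) PK mulmx1 mulmx_block.
  by rewrite !(mulmx0, mul0mx, addr0, add0r) mulmx1 KZ -scalar_mx_block.
- by rewrite mxdiag_recl.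
- rewrite mulmxA -!(mulmxA P') !mulmx_block !(mulmx0, mul0mx, addr0, add0r).
  by rewrite mulmx1 mul1mx -BE -PA mulmxA KP mul1mx.
Qed.

End JordanExistence.

(** * Means over the unit circle *)

Section ComplexTopology.
Variable R : realType.
Implicit Types (c z : Cplx R) (r e : Cplx R).

Lemma norm_real_complex (x : R) : `|(x%:C)%C : Cplx R| = (`|x|%:C)%C.
Proof. by rewrite normc_def /= expr0n addr0 sqrtr_sqr. Qed.

Lemma norm_le_Re_Im z :
  `|z| <= (`|complex.Re z|%:C)%C + (`|complex.Im z|%:C)%C.
Proof.
rewrite {1}[z]complexE (le_trans (ler_normD _ _)) // lerD //.
  by rewrite norm_real_complex.
rewrite normrM norm_real_complex [`|'i%C|]normc_def /=.
by rewrite expr0n expr1n add0r sqrtr1 mul1r.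
Qed.

Lemma norm_ge_Im z : (`|complex.Im z|%:C)%C <= `|z|.
Proof. by rewrite normc_def lecR -sqrtr_sqr ler_wsqrtr // lerDr sqr_ge0. Qed.

Lemma complex_continuous :
  continuous (fun p : R * R => (p.1 +i* p.2)%C : Cplx R).
Proof.
move=> p; apply/cvgrPdist_lt => /= e e0.
have eE : e = ((complex.Re e)%:C)%C by rewrite RRe_real // gtr0_real.
have re0 : 0 < complex.Re e / 2 by rewrite divr_gt0 // -ltcR -eE.
have fst_cvg : \forall q \near p, `|p.1 - q.1| < complex.Re e / 2.
  by apply: (@cvgr_dist_lt _ _ _ (nbhs p) _ fst) => //; exact: cvg_fst.
have snd_cvg : \forall q \near p, `|p.2 - q.2| < complex.Re e / 2.
  by apply: (@cvgr_dist_lt _ _ _ (nbhs p) _ snd) => //; exact: cvg_snd.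
near=> q.
apply: le_lt_trans (norm_le_Re_Im _) _; rewrite /=.
rewrite eE -rmorphD /= ltcR [ltRHS]splitr ltrD //; near: q.
  exact: fst_cvg.
exact: snd_cvg.
Unshelve. all: by end_near. Qed.

Lemma closed_cball c r : r \is Num.real -> closed [set z | `|z - c| <= r].
Proof.
move=> rr z clz; apply/ler_addgt0Pr => e e0.
have [y [/= yB zy]] := clz _ (nbhsx_ballx z e e0).
by rewrite -(subrKA y) addrC (le_trans (ler_normD _ _)) // lerD // ltW.
Qed.

(** The disc is a closed subset of the image of a compact square of [R * R]. *)
Lemma compact_cball c r : compact [set z | `|z - c| <= r].
Proof.
(* The order on [Cplx R] is partial: a point of the disc forces [0 <= r], so a non-real [r] gives
   the empty set. *)
have [rr|nr] := boolP (r \is Num.real); last first.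
  rewrite (_ : mkset _ = set0); first exact: compact0.
  apply/seteqP; split=> // z /= zr; case/negP: nr.
  by rewrite ger0_real // (le_trans _ zr).
have rE : r = ((complex.Re r)%:C)%C by rewrite RRe_real.
pose S (x : R) := `[x - complex.Re r, x + complex.Re r]%classic.
apply: (@subclosed_compact _ _ ((fun p : R * R => (p.1 +i* p.2)%C : Cplx R) @`
  (S (complex.Re c) `*` S (complex.Im c)))).
- exact: closed_cball.
- apply: continuous_compact.
    by apply: continuous_subspaceT; exact: complex_continuous.
  by apply: compact_setX; exact: segment_compact.
move=> z /= zc; exists (complex.Re z, complex.Im z); last by case: (z).
split; rewrite /S /= in_itv /= -ler_distl -lecR -rE.
  by rewrite -raddfB; apply: le_trans (normc_ge_Re _) _.
by rewrite -raddfB; apply: le_trans (norm_ge_Im _) _.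
Qed.

End ComplexTopology.

(** * Roots of unity tending to 1 *)

Section CircleRoots.
Variable R : realType.
Implicit Types (z w : Cplx R) (g h psi : Cplx R -> Cplx R) (e M : Cplx R).

Lemma sqrt_Re_ge0 z : exists s, s ^+ 2 = z /\ 0 <= 'Re s.
Proof.
have [ge0|lt0] := real_leP (real0 _) (Creal_Re (sqrtC z)).
  by exists (sqrtC z); rewrite sqrtCK.
by exists (- sqrtC z); rewrite sqrrN sqrtCK raddfN oppr_ge0 ltW.
Qed.

(** Iterated square roots of -1, always with nonnegative real part, replace the exponential. If
    [s ^+ 2 = z] and [|s| = 1], then [z - 1 = (s - 1)(s + 1)] with [|s + 1| ^+ 2 = 2 + 2 Re s >= 2],
    so each step at least halves the squared distance to 1, which starts at 4. *)
Lemma ex_circle_root : exists om : nat -> Cplx R,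
  [/\ forall m, om m ^+ (2 ^ m.+1) = 1, forall m, om m != 1 &
      forall m, `|om m - 1| ^+ 2 * m%:R <= 4].
Proof.
have [sq sqP] := choice sqrt_Re_ge0.
pose om m := iter m sq (-1).
have om2 m : om m.+1 ^+ 2 = om m by have [] := sqP (om m).
have om1 m : om m ^+ (2 ^ m.+1) = 1.
  elim: m => [|m IH]; first by rewrite expn1 sqrrN expr1n.
  by rewrite expnS exprM om2.
have norm_om m : `|om m| = 1.
  have : `|om m| ^+ (2 ^ m.+1) = 1 by rewrite -normrX om1 normr1.
  by move/eqP; rewrite pexpr_eq1 // ?expn_gt0 // => /eqP.
exists om; split => // [m|m].
  elim: m => [|m]; first by rewrite /om /= eqNr oner_eq0.
  by apply: contraNneq => om_eq1; rewrite -om2 om_eq1 expr1n.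
have : `|om m - 1| ^+ 2 * (2 ^ m)%:R <= 4.
  elim: m => [|m IH].
    rewrite /om /= expn0 mulr1 -opprD normrN.
    by rewrite -[1 + 1]/(2%:R) normr_nat -natrX ler_nat.
  apply: le_trans IH; rewrite -(om2 m) subr_sqr_1 normrM exprMn -[leRHS]mulrA.
  rewrite ler_wpM2l ?exprn_ge0 // expnS natrM ler_wpM2r //.
  have [_ Re_ge0] := sqP (om m); move: Re_ge0; rewrite -/(om m.+1) => Re_ge0.
  rewrite normCK rmorphD rmorph1 mulrDl mulrDr mul1r mulr1 -normCK norm_om.
  rewrite expr1n addrAC -addrA [leRHS](_ : _ = 2 + 2 * 'Re (om m.+1)).
    by rewrite lerDl mulr_ge0.
  by rewrite ReE mulrCA mulfV ?pnatr_eq0 // mulr1; ring.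
apply: le_trans; rewrite ler_wpM2l ?exprn_ge0 // ler_nat ltnW //.
exact: ltn_expl.
Qed.

End CircleRoots.

Lemma ultra_fmap (T V : Type) (u : T -> V) (F : set_system T) :
  UltraFilter F -> UltraFilter (u @ F).
Proof.
move=> UF; split; first exact: fmap_proper_filter.
move=> G PG sFG; apply/seteqP; split; last exact: sFG.
move=> A GA; have [//|FnA] := in_ultra_setVsetC (u @^-1` A) UF.
have GnA : G (~` A) by apply: sFG.
have [x []] := filter_ex (filterI GA GnA); by [].
Qed.

Section CircleMean.
Variable R : realType.
Implicit Types (z w : Cplx R) (g h psi : Cplx R -> Cplx R) (e M : Cplx R).

Definition circle_root : nat -> Cplx R := projT1 (cid (@ex_circle_root R)).

Lemma circle_rootX m : circle_root m ^+ (2 ^ m.+1) = 1.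
Proof. by rewrite /circle_root; case: cid => om []. Qed.

Lemma circle_root_neq1 m : circle_root m != 1.
Proof. by rewrite /circle_root; case: cid => om []. Qed.

Lemma norm_circle_rootX m j : `|circle_root m ^+ j| = 1.
Proof.
have : `|circle_root m| ^+ (2 ^ m.+1) = 1 by rewrite -normrX circle_rootX normr1.
move/eqP; rewrite pexpr_eq1 // ?expn_gt0 // => /eqP om1.
by rewrite normrX om1 expr1n.
Qed.

Lemma circle_root_near1 e : 0 < e -> \forall m \near \oo, `|circle_root m - 1| < e.
Proof.
move=> e0; have [N lt_N] : exists N : nat, 4 / e ^+ 2 < N%:R.
  have : 4 / e ^+ 2 \is Num.real by rewrite realM ?realV ?realX ?gtr0_real.
  case/complex_realP => x ->; exists (Num.truncn x).+1.
  rewrite -[X in _ < X](rmorph_nat (real_complex R)) ltcR.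
  exact: truncnS_gt.
exists N => // m /= le_Nm; have := projT2 (cid (@ex_circle_root R)).
rewrite -/circle_root => -[_ _ /(_ m)]; apply: contraTT => /=.
rewrite -real_leNgt ?normr_real ?gtr0_real // => le_e.
rewrite -real_ltNge ?realM ?realX ?normr_real ?realn //.
move: lt_N; rewrite ltr_pdivrMr ?exprn_gt0 // => /lt_le_trans; apply.
by rewrite mulrC ler_pM ?exprn_ge0 ?(ltW e0) // ?ler_nat // lerXn2r // nnegrE // ltW.
Qed.

Definition riemann_sum m g : Cplx R :=
  (2 ^ m.+1)%:R^-1 * \sum_(j < 2 ^ m.+1) g (circle_root m ^+ j).

Lemma ex_ultra_oo : exists U : set_system nat, UltraFilter U /\ \oo `<=` U.
Proof. exact: ultraFilterLemma. Qed.

Definition ultra_oo : set_system nat := projT1 (cid ex_ultra_oo).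

Instance ultra_ooP : UltraFilter ultra_oo.
Proof. by have [] := projT2 (cid ex_ultra_oo). Qed.

Instance ultra_oo_proper : ProperFilter ultra_oo.
Proof. exact: ultra_proper. Qed.

Lemma near_ultra_oo (P : set nat) : (\forall m \near \oo, P m) -> ultra_oo P.
Proof. by have [_] := projT2 (cid ex_ultra_oo); apply. Qed.

(* Mean over the unit circle; an ultrafilter limit of Riemann sums is linear on
   all bounded functions, so no integrability side conditions arise. *)
Definition mean g : Cplx R := lim (riemann_sum ^~ g @ ultra_oo).

Definition circle_bounded M g := forall w, `|w| = 1 -> `|g w| <= M.

Lemma riemann_sum_le M g m : circle_bounded M g -> `|riemann_sum m g| <= M.
Proof.
move=> gM; rewrite normrM normfV normr_nat ler_pdivrMl ?ltr0n ?expn_gt0 //.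
rewrite (le_trans (ler_norm_sum _ _ _)) //.
apply: le_trans (ler_sum _ (G := fun=> M) _) _.
  by move=> j _; rewrite gM ?norm_circle_rootX.
by rewrite sumr_const card_ord mulr_natl.
Qed.

(** The Riemann sums of a bounded function stay in a compact disc, where every ultrafilter
    converges. *)
Lemma mean_cvg M g : circle_bounded M g ->
  riemann_sum ^~ g @ ultra_oo --> mean g.
Proof.
move=> gM; have := @compact_cball R 0 M; rewrite compact_ultra => /(_ _ (ultra_fmap _ _)).
move=> /(_ (riemann_sum ^~ g)) [].
  apply: (@filterE _ ultra_oo) => m; rewrite /= subr0.
  exact: riemann_sum_le.
by move=> p [_ cvp]; apply/cvg_ex; exists p.
Qed.

Lemma mean_eq g h : (forall w, `|w| = 1 -> g w = h w) -> mean g = mean h.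
Proof.
move=> gh; rewrite /mean; suff -> : riemann_sum ^~ g = riemann_sum ^~ h by [].
apply: funext => m; congr (_ * _).
by apply: eq_bigr => j _; rewrite gh ?norm_circle_rootX.
Qed.

Lemma norm_lim_le M (u : nat -> Cplx R) l :
  (forall e, 0 < e -> \forall m \near ultra_oo, `|u m| <= M + e) ->
  u @ ultra_oo --> l -> `|l| <= M.
Proof.
move=> uM ul; apply/ler_addgt0Pr => e e0.
have e20 : 0 < e / 2 by rewrite divr_gt0.
have lu : \forall m \near ultra_oo, `|l - u m| < e / 2.
  by apply: (@cvgr_dist_lt _ _ _ ultra_oo _ u) => //; exact: ul.
have [m [um le_m]] := filter_ex (filterI lu (uM _ e20)).
rewrite -(subrK (u m) l) (le_trans (ler_normD _ _)) // [e]splitr addrA addrC.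
by rewrite lerD // ltW.
Qed.

Lemma mean_le M g : circle_bounded M g -> `|mean g| <= M.
Proof.
move=> gM; apply: norm_lim_le (mean_cvg gM) => e e0.
by apply: filterE => m; rewrite (le_trans (riemann_sum_le _ gM)) // lerDl ltW.
Qed.

Lemma mean_cst z : mean (fun=> z) = z.
Proof.
rewrite /mean (_ : riemann_sum ^~ _ = cst z) ?lim_cst //.
apply: funext => m; rewrite /riemann_sum sumr_const card_ord -[z *+ _]mulr_natl mulrA.
by rewrite mulVf ?mul1r // pnatr_eq0 -lt0n expn_gt0.
Qed.

Lemma meanD M M' g h : circle_bounded M g -> circle_bounded M' h ->
  mean (fun w => g w + h w) = mean g + mean h.
Proof.
move=> gM hM; apply: cvg_lim => //.
rewrite (_ : riemann_sum ^~ _ = riemann_sum ^~ g + riemann_sum ^~ h).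
  exact: cvgD (mean_cvg gM) (mean_cvg hM).
by apply: funext => m; rewrite /riemann_sum big_split mulrDr.
Qed.

Lemma meanZ M z g : circle_bounded M g -> mean (fun w => z * g w) = z * mean g.
Proof.
move=> gM; apply: cvg_lim => //.
rewrite (_ : riemann_sum ^~ _ = (fun m => z * riemann_sum m g)).
  by apply: cvgMr; exact: mean_cvg gM.
by apply: funext => m; rewrite /riemann_sum -mulr_sumr mulrCA.
Qed.

Lemma meanB M M' g h : circle_bounded M g -> circle_bounded M' h ->
  mean (fun w => g w - h w) = mean g - mean h.
Proof.
move=> gM hM; rewrite (meanD gM (M' := M')); last first.
  by move=> w w1; rewrite normrN hM.
congr (_ + _); rewrite -mulN1r -(meanZ _ hM).
by apply: mean_eq => w _; rewrite mulN1r.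
Qed.

Lemma mean_conj M g : circle_bounded M g ->
  mean (fun w => (g w)^*) = (mean g)^*.
Proof.
move=> gM; apply: cvg_lim => //; apply/cvgrPdist_lt => e e0.
have : \forall m \near ultra_oo, `|mean g - riemann_sum m g| < e.
  apply: (@cvgr_dist_lt _ _ _ ultra_oo _ (riemann_sum ^~ g)) => //.
  exact: mean_cvg gM.
apply: filterS => m.
rewrite -[ltLHS]norm_conjC rmorphB; congr (`|_ - _| < _).
rewrite /riemann_sum rmorphM rmorphV ?unitfE ?pnatr_eq0 -?lt0n ?expn_gt0 //.
by rewrite rmorph_nat rmorph_sum.
Qed.

(** The integral of a derivative along a closed curve vanishes. The increments of [psi] along the
    powers of [om] telescope to 0, and each is [psi' x * x * (om - 1)] up to [e * |om - 1|];
    dividing by [om - 1] leaves a Riemann sum of norm at most [e]. *)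
Lemma mean_deriv M psi psi' : circle_bounded M psi' ->
  (forall e, 0 < e -> exists2 d, 0 < d & forall x y, `|x| = 1 -> `|y| = 1 ->
     `|y - x| < d -> `|psi y - psi x - psi' x * (y - x)| <= e * `|y - x|) ->
  mean (fun w => psi' w * w) = 0.
Proof.
move=> psiM psi_diff; have bnd : circle_bounded M (fun w => psi' w * w).
  by move=> w w1; rewrite normrM w1 mulr1 psiM.
apply/eqP; rewrite -normr_le0; apply: norm_lim_le (mean_cvg bnd) => e e0.
have [d d0 psi_d] := psi_diff e e0; rewrite add0r.
apply/near_ultra_oo; have := circle_root_near1 d0; apply: filterS => m lt_d.
set om := circle_root m in lt_d *; set N := (2 ^ m.+1)%N.
have N_gt0 : (0 : Cplx R) < N%:R by rewrite ltr0n expn_gt0.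
have om1_neq0 : `|om - 1| != 0 by rewrite normr_eq0 subr_eq0 circle_root_neq1.
have tele : \sum_(j < N) (psi (om ^+ j.+1) - psi (om ^+ j)) = 0.
  rewrite -(big_mkord xpredT (fun j => psi (om ^+ j.+1) - psi (om ^+ j))) /=.
  by rewrite telescope_sumr // expr0 /om circle_rootX subrr.
rewrite /riemann_sum normrM normfV normr_nat ler_pdivrMl // -/om -/N.
rewrite -(ler_pM2r (_ : 0 < `|om - 1|)) ?lt0r ?om1_neq0 ?normr_ge0 //.
rewrite -normrM mulr_suml -normrN -[X in `|X|]add0r -{1}tele -sumrB.
apply: le_trans (ler_norm_sum _ _ _) _.
apply: le_trans (ler_sum _ (G := fun=> e * `|om - 1|) _) _; last first.
  by rewrite sumr_const card_ord -[(e * _) *+ _]mulr_natl mulrA.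
move=> j _; have normE : `|om ^+ j.+1 - om ^+ j| = `|om - 1|.
  by rewrite exprS -{2}[om ^+ j]mul1r -mulrBl normrM norm_circle_rootX mulr1.
rewrite -normE -mulrA mulrBr mulr1 -exprSr; apply: psi_d; rewrite ?norm_circle_rootX //.
by rewrite normE.
Qed.

End CircleMean.

(** * Complex derivatives *)

Section DerivativeBounds.
Variables (K : numFieldType).

(* [derive1] with values in [K] itself rather than in its normed module. *)
Definition kderive (f : K -> K) : K -> K := derive1 f.

Lemma near_distP (V : normedModType K) (a : V) (P : V -> Prop) :
  (\forall y \near a, P y) <->
  exists2 d : K, 0 < d & forall y, `|y - a| < d -> P y.
Proof.
split=> [/nbhs_normP [d /= d0 dP]|[d d0 dP]].
  by exists d => // y ya; apply: dP; rewrite /= distrC.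
by apply/nbhs_normP; exists d => // y; rewrite /= distrC; exact: dP.
Qed.

Lemma derivable_bound (f : K -> K) (a : K) : derivable f a 1 ->
  forall e : K, 0 < e -> \forall y \near a,
    `|f y - f a - kderive f a * (y - a)| <= e * `|y - a|.
Proof.
move=> df e e0; have /eqaddoP/(_ e e0)/near_distP[d d0 dP] := derivable_nbhs df.
apply/near_distP; exists d => // y ya; have := dP (y - a); rewrite subr0 => /(_ ya).
rewrite /= opprD -![(_ + _ : _ -> _) _]/(_ + _) -![(- _ : _ -> _) _]/(- _) /cst /=.
by rewrite addrA [_%:A]mulr1 subrK /kderive derive1E [_ *: _]mulrC.
Qed.

Lemma bound_is_derive (f : K -> K) (a l : K) :
  (forall e : K, 0 < e -> \forall y \near a,
    `|f y - f a - l * (y - a)| <= e * `|y - a|) -> is_derive a 1 f l.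
Proof.
move=> fl.
have cv : (fun h => h^-1 *: ((f \o shift a) (h *: 1) - f a)) @ 0^' --> l.
  apply/cvgrPdist_le => e e0; have /near_distP[d d0 dP] := fl e e0.
  apply/nbhs_ballP; exists d => //= h; rewrite /ball /= sub0r normrN => hd h0.
  have := dP (h + a); rewrite addrK => /(_ hd) fh.
  rewrite /= [h%:A]mulr1 distrC -[l](mulKf h0) -[_ *: _]/(_ * _) -mulrBr normrM.
  by rewrite normfV ler_pdivrMl ?normr_gt0 // [h * l]mulrC [_ * e]mulrC.
by split; [apply/cvg_ex; exists l | exact: cvg_lim].
Qed.

Lemma is_derive_derive1 (f : K -> K) (a l : K) :
  is_derive a 1 f l -> derivable f a 1 /\ kderive f a = l.
Proof. by move=> [? ?]; rewrite /kderive derive1E. Qed.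

End DerivativeBounds.

Section RealEmbedding.
Variable R : realType.
Implicit Types x y : R.

HB.instance Definition _ :=
  GRing.RMorphism.copy (@cplx_of_real R) (real_complex R).

Lemma ler_cplx x y : (cplx_of_real x <= cplx_of_real y) = (x <= y).
Proof. exact: lecR. Qed.

Lemma ltr_cplx x y : (cplx_of_real x < cplx_of_real y) = (x < y).
Proof. exact: ltcR. Qed.

Lemma ler0_cplx x : (0 <= cplx_of_real x) = (0 <= x).
Proof. exact: lecR. Qed.

Lemma ltr0_cplx x : (0 < cplx_of_real x) = (0 < x).
Proof. exact: ltcR. Qed.

Lemma norm_cplx x : `|cplx_of_real x| = cplx_of_real `|x|.
Proof. exact: norm_real_complex. Qed.

Lemma ReK (z : Cplx R) : z \is Num.real -> cplx_of_real (complex.Re z) = z.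
Proof. exact: RRe_real. Qed.

Lemma norm_Re_le (z : Cplx R) : cplx_of_real `|complex.Re z| <= `|z|.
Proof. exact: normc_ge_Re. Qed.

Lemma cplxB x y : cplx_of_real (x - y) = cplx_of_real x - cplx_of_real y.
Proof. exact: (rmorphB (real_complex R)). Qed.

Lemma cplxM x y : cplx_of_real (x * y) = cplx_of_real x * cplx_of_real y.
Proof. exact: (rmorphM (real_complex R)). Qed.

Lemma ReB (z w : Cplx R) : complex.Re (z - w) = complex.Re z - complex.Re w.
Proof. by case: z => a b; case: w => c d. Qed.

End RealEmbedding.

(** * The mean value inequality along a complex segment *)

Section MeanValue.
Variable R : realType.
Implicit Types (x y z w L : Cplx R) (f : Cplx R -> Cplx R).

(** The real mean value theorem is applied to [phi], the real part of the product of the conjugate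
    of [v] with [f - L] along the segment. Its total increment is [|v| ^+ 2] and its derivative is
    at most [|v| * (e * |y - x|)]; one factor [|v|] cancels. *)
Lemma mean_value_bound f x y L (e : Cplx R) :
  (forall t : R, 0 <= t <= 1 ->
     let u := x + cplx_of_real t * (y - x) in
     derivable f u 1 /\ `|kderive f u - L| <= e) ->
  `|f y - f x - L * (y - x)| <= e * `|y - x|.
Proof.
move=> fe; set v := f y - f x - L * (y - x).
pose u (t : R) : Cplx R := x + cplx_of_real t * (y - x).
pose phi t := complex.Re (v^* * (f (u t) - L * (cplx_of_real t * (y - x)))).
pose dphi t := complex.Re (v^* * (kderive f (u t) - L) * (y - x)).
have phi_drv (t : R) : 0 <= t <= 1 -> is_derive t 1 phi (dphi t).
  move=> t01; apply: bound_is_derive => e' e'0.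
  have [df _] := fe t t01.
  pose k := `|v| * `|y - x| + 1; have k0 : 0 < k by rewrite ltr_wpDl ?mulr_ge0.
  have e'k : 0 < cplx_of_real e' / k by rewrite divr_gt0 // ltr0_cplx.
  have /near_distP[d d0 dP] := derivable_bound df e'k.
  pose d' := d / (`|y - x| + 1).
  have d'0 : 0 < d' by rewrite divr_gt0 // ltr_wpDl.
  apply/near_distP; exists (complex.Re d'); first by rewrite -ltr0_cplx ReK ?gtr0_real.
  move=> s; rewrite -ltr_cplx ReK ?gtr0_real // -norm_cplx => s_t.
  have uE : u s - u t = cplx_of_real (s - t) * (y - x) by rewrite /u cplxB; ring.
  have := dP (u s); rewrite uE normrM.
  have -> : `|cplx_of_real (s - t) : Cplx R| * `|y - x| < d.
    apply: le_lt_trans (_ : `|cplx_of_real (s - t) : Cplx R| * (`|y - x| + 1) < d).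
      by rewrite ler_wpM2l // lerDl.
    by rewrite -ltr_pdivlMr // ltr_wpDl.
  move=> /(_ isT) bnd; rewrite -ler_cplx cplxM -!norm_cplx.
  have -> : phi s - phi t - dphi t * (s - t) = complex.Re (v^* *
      (f (u s) - f (u t) - kderive f (u t) * (cplx_of_real (s - t) * (y - x)))).
    rewrite /phi /dphi.
    have reM (z : Cplx R) (r : R) : complex.Re z * r = complex.Re (z * cplx_of_real r).
      by case: z => a b /=; rewrite mulr0 subr0.
    rewrite reM -!ReB; congr complex.Re.
    move: (v^*) => vc; rewrite cplxB; ring.
  rewrite norm_cplx; apply: le_trans (norm_Re_le _) _.
  rewrite normrM norm_conjC.
  apply: le_trans (ler_wpM2l (normr_ge0 _) bnd) _.
  set E := cplx_of_real e'; set S := `|cplx_of_real (s - t)|.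
  rewrite [leLHS](_ : _ = E * S * (`|v| * `|y - x| / k)); last by ring.
  apply: ler_piMr.
    by rewrite mulr_ge0 ?normr_ge0 // ler0_cplx ltW.
  by rewrite ler_pdivrMr // mul1r lerDl ler01.
have u0 : u 0 = x by rewrite /u rmorph0 mul0r addr0.
have u1 : u 1 = y by rewrite /u rmorph1 mul1r addrC subrK.
have [c c01 phiE] : exists2 c, c \in `[0, 1]%R & phi 1 - phi 0 = dphi c * (1 - 0).
  apply: MVT_segment => // [t t01|].
    by apply: phi_drv; move: t01; rewrite in_itv /= => /andP[]; do 2!move/ltW->.
  apply: derivable_within_continuous => t; rewrite in_itv /= => t01.
  by have [] := phi_drv t t01.
have [_ bnd] := fe c c01.
have vv : `|v| ^+ 2 = cplx_of_real (phi 1 - phi 0).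
  rewrite normCK mulrC /phi u0 u1 rmorph0 mul0r mulr0 subr0 rmorph1 mul1r.
  rewrite -ReB -mulrBr.
  rewrite (_ : f y - _ - f x = v); last by rewrite /v; ring.
  by rewrite ReK // mulrC -normCK realX.
have le_vv : `|v| ^+ 2 <= `|v| * (e * `|y - x|).
  have := congr1 Num.norm vv; rewrite ger0_norm ?exprn_ge0 // => ->.
  rewrite phiE subr0 mulr1 norm_cplx.
  apply: le_trans (norm_Re_le _) _; rewrite !normrM norm_conjC -mulrA.
  by rewrite ler_wpM2l // ler_wpM2r.
have [v0|v_neq0] := eqVneq v 0; last first.
  by rewrite expr2 ler_pM2l ?normr_gt0 in le_vv.
rewrite v0 normr0 mulr_ge0 //; apply: le_trans bnd; exact: normr_ge0.
Qed.

End MeanValue.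

(** * Holomorphic functions *)

Section Holomorphic.
Variable R : realType.
Implicit Types (x y z w l : Cplx R) (f g df : Cplx R -> Cplx R).

(** Being C^1 on a neighbourhood is an open condition, and continuity of the derivative is what
    makes differentiability uniform on discs. The higher derivatives are recovered in
    [hol_kderive]. *)
Definition hol f z := \forall w \near z,
  derivable f w 1 /\ {for w, continuous (kderive f)}.

Lemma near_near z (P : Cplx R -> Prop) :
  (\forall w \near z, P w) -> \forall w \near z, \forall w' \near w, P w'.
Proof. by move=> /nbhs_interior. Qed.

Lemma near_all z (P : Cplx R -> Prop) : (forall w, P w) -> \forall w \near z, P w.
Proof. by move=> allP; exact: filterE. Qed.

Lemma is_derive_kderive f z l : is_derive z 1 f l -> kderive f z = l.
Proof. by case/is_derive_derive1. Qed.

Lemma derivable_is_derive f z : derivable f z 1 -> is_derive z 1 f (kderive f z).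
Proof. by move=> df; rewrite /kderive derive1E; exact: derivableP. Qed.

Lemma derivable_continuous f z : derivable f z 1 -> {for z, continuous f}.
Proof. by move=> /derivable1_diffP /differentiable_continuous. Qed.

Lemma near_continuous f g z : (\forall w \near z, f w = g w) ->
  {for z, continuous f} -> {for z, continuous g}.
Proof.
move=> fg; rewrite /prop_for /continuous_at -(nbhs_singleton fg) => cf A /cf.
by apply: filterS2 fg => w /= ->.
Qed.

Lemma hol_intro f df z : (\forall w \near z, is_derive (w : Cplx R) 1 f (df w)) ->
  (\forall w \near z, {for w, continuous df}) -> hol f z.
Proof.
move=> /near_near fdf cdf; apply: filterS2 fdf cdf => w fdf cdf; split.
  by have := nbhs_singleton fdf; case.
apply: near_continuous cdf; apply: filterS fdf => w' /is_derive_kderive.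
exact: esym.
Qed.

Lemma hol_near f z : hol f z -> \forall w \near z, hol f w.
Proof. exact: near_near. Qed.

Lemma hol_derivable f z : hol f z -> derivable f z 1.
Proof. by move=> /nbhs_singleton []. Qed.

Lemma hol_derive_continuous f z : hol f z -> {for z, continuous (kderive f)}.
Proof. by move=> /nbhs_singleton []. Qed.

Lemma hol_continuous f z : hol f z -> {for z, continuous f}.
Proof. by move/hol_derivable/derivable_continuous. Qed.

Lemma hol_near_eq f g z : (\forall w \near z, f w = g w) -> hol f z -> hol g z.
Proof.
move=> /near_near fg hf; apply: (@hol_intro _ (kderive f)).
  apply: filterS2 fg (hol_near hf) => w fg hf'.
  by apply: near_eq_is_derive fg _; apply: derivable_is_derive; exact: hol_derivable.
by apply: filterS (hol_near hf) => w; exact: hol_derive_continuous.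
Qed.

Lemma hol_cst (a : Cplx R) z : hol (fun=> a) z.
Proof.
apply: (@hol_intro _ (fun=> 0)); apply: near_all => w; first exact: is_derive_cst.
exact: (@cst_continuous _ _ (0 : Cplx R) w).
Qed.

Lemma hol_id z : hol id z.
Proof.
apply: (@hol_intro _ (fun=> 1)); apply: near_all => w; first exact: is_derive_id.
exact: (@cst_continuous _ _ (1 : Cplx R) w).
Qed.

Lemma holD f g z : hol f z -> hol g z -> hol (fun w => f w + g w) z.
Proof.
move=> /hol_near hf /hol_near hg.
apply: (@hol_intro _ (fun w => kderive f w + kderive g w));
  apply: filterS2 hf hg => w hf hg.
  apply: (@is_deriveD _ _ _ f g); apply: derivable_is_derive; exact: hol_derivable.
by apply: (@continuousD _ _ _ (kderive f) (kderive g)); exact: hol_derive_continuous.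
Qed.

Lemma holM f g z : hol f z -> hol g z -> hol (fun w => f w * g w) z.
Proof.
move=> /hol_near hf /hol_near hg.
apply: (@hol_intro _ (fun w => f w * kderive g w + g w * kderive f w));
  apply: filterS2 hf hg => w hf hg.
  apply: (@is_deriveM _ _ f g); apply: derivable_is_derive; exact: hol_derivable.
apply: (@continuousD _ _ _ (fun w => f w * kderive g w) (fun w => g w * kderive f w)).
  by apply: (@continuousM _ _ f (kderive g)); [exact: hol_continuous | exact: hol_derive_continuous].
by apply: (@continuousM _ _ g (kderive f)); [exact: hol_continuous | exact: hol_derive_continuous].
Qed.

Lemma holB f g z : hol f z -> hol g z -> hol (fun w => f w - g w) z.
Proof.
move=> hf hg; apply: hol_near_eq (holD hf (holM (hol_cst (-1) z) hg)).
by apply: near_all => w; rewrite mulN1r.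
Qed.

Lemma holV g z : hol g z -> g z != 0 -> hol (fun w => (g w)^-1) z.
Proof.
move=> hg gz.
have gw : \forall w \near z, hol g w /\ g w != 0.
  apply: filterI; first exact: hol_near.
  by apply: (@cvgr_neq0 _ _ _ (nbhs z) _ g (g z)) gz; exact: hol_continuous.
apply: (@hol_intro _ (fun w => - (g w) ^- 2 * kderive g w)); apply: filterS gw => w [hw nz].
  have dg := hol_derivable hw; apply: DeriveDef; first exact: derivableV.
  apply: etrans (deriveV nz dg) _.
  rewrite -derive1E -/(kderive g w).
  move: (kderive g w) (- g w ^- 2) => a b.
  exact: erefl.
apply: (@continuousM _ _ (fun w => - (g w) ^- 2) (kderive g)); last exact: hol_derive_continuous.
apply: continuousN; apply: continuousV; first by rewrite expf_neq0.
by apply: (@continuousM _ _ g g); exact: hol_continuous.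
Qed.

End Holomorphic.

(** * Cauchy's formula *)

Section UniformDifferentiability.
Variable R : realType.
Implicit Types (c x y z w : Cplx R) (r e d M : Cplx R) (f g : Cplx R -> Cplx R).

Lemma near_dist z (P : Cplx R -> Prop) : (\forall w \near z, P w) ->
  exists2 d : Cplx R, 0 < d & forall w, `|w - z| < d -> P w.
Proof. by move/near_distP. Qed.

Lemma convex_dist (t : R) (x y p : Cplx R) d : 0 <= t <= 1 ->
  `|x - p| < d -> `|y - p| < d -> `|x + cplx_of_real t * (y - x) - p| < d.
Proof.
move=> /andP[t0 t1] xd yd; set T := cplx_of_real t.
have T0 : 0 <= T by rewrite ler0_cplx.
have T1 : 0 <= 1 - T by rewrite subr_ge0 -[1](rmorph1 (@cplx_of_real R)) ler_cplx.
rewrite (_ : _ - p = (1 - T) * (x - p) + T * (y - p)); last by ring.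
apply: le_lt_trans (ler_normD _ _) _; rewrite !normrM (ger0_norm T0) (ger0_norm T1).
have [->|T_neq0] := eqVneq T 0; first by rewrite subr0 mul1r mul0r addr0.
rewrite [ltRHS](_ : d = (1 - T) * d + T * d); last by ring.
by rewrite ler_ltD //; [rewrite ler_wpM2l // ltW | rewrite ltr_pM2l // lt0r T_neq0].
Qed.

Lemma convex_dist_le (t : R) (x y p : Cplx R) d : 0 <= t <= 1 ->
  `|x - p| <= d -> `|y - p| <= d -> `|x + cplx_of_real t * (y - x) - p| <= d.
Proof.
move=> /andP[t0 t1] xd yd; set T := cplx_of_real t.
have T0 : 0 <= T by rewrite ler0_cplx.
have T1 : 0 <= 1 - T by rewrite subr_ge0 -[1](rmorph1 (@cplx_of_real R)) ler_cplx.
rewrite (_ : _ - p = (1 - T) * (x - p) + T * (y - p)); last by ring.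
apply: le_trans (ler_normD _ _) _; rewrite !normrM (ger0_norm T0) (ger0_norm T1).
rewrite [leRHS](_ : d = (1 - T) * d + T * d); last by ring.
by rewrite lerD ?ler_wpM2l.
Qed.

(** Both points may move: the mean value inequality with slope [kderive f p] costs [e / 2], and
    continuity of the derivative pays for replacing that slope by [kderive f x]. *)
Lemma strict_diff f p e : hol f p -> 0 < e -> exists2 d, 0 < d &
  forall x y, `|x - p| < d -> `|y - p| < d ->
    `|f y - f x - kderive f x * (y - x)| <= e * `|y - x|.
Proof.
move=> hf e0; have e20 : 0 < e / 2 by rewrite divr_gt0.
have fp : \forall u \near p, `|kderive f p - kderive f u| < e / 2.
  apply: (@cvgr_dist_lt _ _ _ (nbhs p) _ (kderive f)) => //.
  exact: hol_derive_continuous.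
have [d d0 dP] := near_dist (filterI (hol_near hf) fp).
exists d => // x y xd yd; set L := kderive f p.
rewrite (_ : _ - _ = (f y - f x - L * (y - x)) + (L - kderive f x) * (y - x)); last by ring.
apply: le_trans (ler_normD _ _) _; rewrite [in leRHS](splitr e) [leRHS]mulrDl lerD //; last first.
  by rewrite normrM ler_wpM2r // ltW //; have [] := dP x xd.
apply: mean_value_bound => t t01 /=.
have [hu ltu] := dP _ (convex_dist t01 xd yd).
by split; [exact: hol_derivable | rewrite distrC ltW].
Qed.

Lemma unif_diff f c r e : (forall z, `|z - c| <= r -> hol f z) -> 0 < e ->
  exists2 d, 0 < d & forall x y, `|x - c| <= r -> `|y - x| < d ->
    `|f y - f x - kderive f x * (y - x)| <= e * `|y - x|.
Proof.
move=> hf e0; have := @compact_cball R c r; rewrite compact_near_coveringP.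
(* The covering parameter runs over a neighbourhood of 0 in [Cplx R], whose elements need not be
   positive; hence the radius [|d|], to be used at the positive value [d / 2]. *)
move=> /(_ (Cplx R) (nbhs (0 : Cplx R)) (fun d x => forall y, `|y - x| < `|d| ->
  `|f y - f x - kderive f x * (y - x)| <= e * `|y - x|) _) [].
  move=> p /= pr; have [d d0 dP] := strict_diff (hf p pr) e0.
  have d20 : 0 < d / 2 by rewrite divr_gt0.
  have Np : \forall x \near p, `|x - p| < d / 2 by apply/near_distP; exists (d / 2).
  have N0 : \forall x \near (0 : Cplx R), `|x| < d / 2.
    by apply/near_distP; exists (d / 2) => // x; rewrite subr0.
  exists ([set x | `|x - p| < d / 2], [set x | `|x| < d / 2]); first by split.
  move=> [x d'] [/= xp d'd] y yx; apply: dP.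
    by apply: lt_trans xp _; rewrite ltr_pdivrMr // ltr_pMr // ltr1n //.
  rewrite -(subrK x y) -addrA (le_lt_trans (ler_normD _ _)) // [d]splitr.
  by rewrite ltrD // (lt_trans yx).
move=> d /= d0 dP; have d20 : 0 < d / 2 by rewrite divr_gt0.
exists (d / 2) => // x y xr yx.
have : ball_ Num.norm 0 d (d / 2).
  rewrite /ball_ /= sub0r normrN gtr0_norm // ltr_pdivrMr // ltr_pMr // ltr1n //.
by move/dP => /(_ x xr y); rewrite (gtr0_norm d20); apply.
Qed.

Lemma cball_bounded f c r :
  (forall z, `|z - c| <= r -> {for z, continuous f}) ->
  exists M, forall z, `|z - c| <= r -> `|f z| <= M.
Proof.
move=> hf; have := @compact_cball R c r; rewrite compact_near_coveringP.
move=> /(_ nat \oo (fun n x => `|f x| <= n%:R) _) [].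
  move=> p /= pr; have cf := hf p pr.
  have Np : \forall x \near p, `|f p - f x| < 1.
    by apply: (@cvgr_dist_lt _ _ _ (nbhs p) _ f).
  have [N le_N] : exists N : nat, `|f p| + 1 <= N%:R.
    exists (Num.truncn (complex.Re (`|f p| + 1))).+1.
    rewrite -[leLHS]ReK ?ger0_real ?addr_ge0 // -(rmorph_nat (@cplx_of_real R)).
    by rewrite ler_cplx ltW // truncnS_gt.
  exists ([set x | `|f p - f x| < 1], [set n | N <= n]%N); first by split=> //; exists N.
  move=> [x n] [/= fx le_Nn]; apply: (@le_trans _ _ N%:R); last by rewrite ler_nat.
  apply: le_trans le_N; rewrite -(subrK (f p) (f x)) addrC.
  by rewrite (le_trans (ler_normD _ _)) // lerD2l distrC ltW.
by move=> N _ /(_ N) /= NP; exists N%:R => z zr; exact: NP.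
Qed.

(** Over [N] equal steps the increments add up to at most [e]. The base point [t] avoids 0 because
    the homotopy below divides by [t]; each step goes from [u j.+1] back to [u j], so 0 occurs only
    as a [t']. *)
Lemma constant_of_small_increments (M : R -> Cplx R) :
  (forall e, 0 < e -> exists2 d, 0 < d & forall t t' : R, 0 < t <= 1 -> 0 <= t' <= 1 ->
     `|cplx_of_real (t' - t)| < d ->
     `|M t' - M t| <= e * `|cplx_of_real (t' - t)|) ->
  M 1 = M 0.
Proof.
move=> Msmall; apply/eqP; rewrite eq_sym -subr_eq0 -normr_le0; apply/ler_addgt0Pr => e e0.
rewrite add0r; have [d d0 dP] := Msmall e e0.
pose N := (Num.truncn (complex.Re d^-1)).+1.
have ltN : N%:R^-1 < complex.Re d.
  rewrite -ltr_cplx ReK ?gtr0_real // -[ltLHS]/(cplx_of_real _) fmorphV rmorph_nat.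
  rewrite invf_plt ?posrE ?ltr0n // -[ltLHS]ReK ?gtr0_real ?invr_gt0 //.
  by rewrite -(rmorph_nat (@cplx_of_real R)) ltr_cplx truncnS_gt.
have N_neq0 : (N%:R : R) != 0 by rewrite pnatr_eq0.
pose u (j : nat) : R := j%:R / N%:R.
have -> : M 0 - M 1 = \sum_(j < N) (M (u j) - M (u j.+1)).
  rewrite -(big_mkord xpredT (fun j => M (u j) - M (u j.+1))) /=.
  under eq_bigr do rewrite -opprB.
  by rewrite sumrN telescope_sumr // opprB /u mul0r divff.
apply: le_trans (ler_norm_sum _ _ _) _.
apply: le_trans (ler_sum _ (G := fun=> e * cplx_of_real N%:R^-1) _) _; last first.
  rewrite sumr_const card_ord -[(e * _) *+ N]mulr_natr -mulrA -(rmorph_nat (@cplx_of_real R)).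
  by rewrite -cplxM mulVf // rmorph1 mulr1.
move=> j _; have uj k : (k <= N)%N -> 0 <= u k <= 1.
  move=> kN; rewrite divr_ge0 ?ler0n //= ler_pdivrMr ?ltr0n // mul1r ler_nat //.
have dist_u : `|cplx_of_real (u j - u j.+1)| = cplx_of_real N%:R^-1.
  rewrite norm_cplx /u -mulrBl -natr1 opprD addNKr mulN1r normrN ger0_norm ?invr_ge0 //.
rewrite -dist_u; apply: dP.
- by have := uj j.+1 (ltn_ord j) => /andP[_ ->]; rewrite andbT divr_gt0 ?ltr0n.
- by apply: uj; rewrite ltnW.
- by rewrite dist_u -[ltRHS]ReK ?gtr0_real // ltr_cplx.
Qed.

End UniformDifferentiability.

(** * Cauchy's formula by a homotopy of circles *)

Section CauchyFormula.
Variable R : realType.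
Implicit Types (a c x y z w : Cplx R) (r e d M : Cplx R) (f g : Cplx R -> Cplx R).

Lemma circle_dist_ge c r z w : 0 < r -> `|w| = 1 ->
  r - `|z - c| <= `|c + r * w - z|.
Proof.
move=> r0 w1; rewrite lerBlDr -{1}[r]gtr0_norm // -[X in X <= _]mulr1 -{1}w1 -normrM.
apply: le_trans (ler_normD _ _); rewrite le_eqVlt; apply/orP; left.
by apply/eqP; congr `|_|; ring.
Qed.

Lemma circle_dist_neq0 c r z w : `|z - c| < r -> `|w| = 1 -> c + r * w - z != 0.
Proof.
move=> zr w1; have r0 : 0 < r := le_lt_trans (normr_ge0 _) zr.
by rewrite -normr_gt0; apply: lt_le_trans (circle_dist_ge c z r0 w1); rewrite subr_gt0.
Qed.

(* Homotopy of the circle of centre c to the point z, along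
   t |-> mean of f (z + t (W - z)) (W - c) / (W - z), where W = c + r w. *)
Lemma cauchy_homotopy f c r z : (forall x, `|x - c| <= r -> hol f x) -> `|z - c| < r ->
  mean (fun w => f (c + r * w) * (r * w / (c + r * w - z))) =
  f z * mean (fun w => r * w / (c + r * w - z)).
Proof.
move=> hf zr; have r0 : 0 < r by exact: le_lt_trans zr.
pose W w := c + r * w; pose k w := r * w / (W w - z).
pose rho := r - `|z - c|; have rho0 : 0 < rho by rewrite subr_gt0.
pose u (t : R) w := z + cplx_of_real t * (W w - z).
pose M (t : R) := mean (fun w => f (u t w) * k w).
have W_in w : `|w| = 1 -> `|W w - c| <= r.
  by move=> w1; rewrite /W addrC addKr normrM w1 mulr1 gtr0_norm.
have u_in t w : 0 <= t <= 1 -> `|w| = 1 -> `|u t w - c| <= r.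
  by move=> t01 w1; apply: convex_dist_le => //; [exact: ltW | exact: W_in].
have nz w : `|w| = 1 -> W w - z != 0 by move=> w1; exact: circle_dist_neq0.
have k_le : circle_bounded (r / rho) k.
  move=> w w1; rewrite /k normrM normrM w1 mulr1 gtr0_norm // ler_pM2l // normfV.
  by rewrite lef_pV2 ?posrE ?normr_gt0 ?nz // circle_dist_ge.
have [B B_ge] := cball_bounded (fun x xr => hol_continuous (hf x xr)).
have Fb t : 0 <= t <= 1 -> circle_bounded (B * (r / rho)) (fun w => f (u t w) * k w).
  move=> t01 w w1; rewrite normrM ler_pM //; last exact: k_le.
  by apply: B_ge; exact: u_in.
have WzE w : `|w| = 1 -> `|W w - z| <= 2 * r.
  move=> w1; rewrite -(subrKA c) mulrDl mul1r (le_trans (ler_normD _ _)) //.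
  by rewrite lerD ?W_in // distrC ltW.
suff : M 1 = M 0.
  have u0 w : u 0 w = z by rewrite /u rmorph0 mul0r addr0.
  have u1 w : u 1 w = W w by rewrite /u rmorph1 mul1r addrC subrK.
  rewrite /M (mean_eq (h := fun w => f (W w) * k w)); last by move=> w _; rewrite u1.
  move=> ->; rewrite (mean_eq (h := fun w => f z * k w)); last by move=> w _; rewrite u0.
  exact: meanZ k_le.
apply: constant_of_small_increments => e e0.
(* Since [|W w - z| * |k w| = r], the tolerance [e / r] for [f] becomes [e] for the integrand. *)
have er0 : 0 < e / r by rewrite divr_gt0.
have [d d0 dP] := unif_diff hf er0.
exists (d / (2 * r)); first by rewrite divr_gt0 ?mulr_gt0.
move=> t t' /andP[t0 t1] t'01 tt'.
have t01 : 0 <= t <= 1 by rewrite ltW.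
set T := cplx_of_real (t' - t).
have uE w : u t' w - u t w = T * (W w - z) by rewrite /u /T cplxB; ring.
have u_close w : `|w| = 1 -> `|u t' w - u t w| < d.
  move=> w1; rewrite uE normrM; apply: le_lt_trans (_ : `|T| * (2 * r) < d).
    by rewrite ler_wpM2l // WzE.
  by rewrite -ltr_pdivlMr // mulr_gt0.
have [B' B'_ge] : exists B', circle_bounded B' (fun w => kderive f (u t w)).
  have [B' B'_ge] := cball_bounded (fun x xr => hol_derive_continuous (hf x xr)).
  by exists B' => w w1; apply: B'_ge; exact: u_in.
(* The derivative of the integrand in [t] is [r * kderive f (u t w) * w], because [k] cancels
   [W w - z]. Up to the factor [t] this is [w] times the derivative of [f (u t w)] in [w], so
   [mean_deriv] applies. *)
have main : mean (fun w => kderive f (u t w) * w) = 0.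
  have tr_neq0 : cplx_of_real t * r != 0.
    by rewrite mulf_neq0 ?gt_eqF // ltr0_cplx.
  apply: (mulfI tr_neq0); rewrite mulr0 -(meanZ (M := B')); last first.
    by move=> w w1; rewrite normrM w1 mulr1 B'_ge.
  rewrite -[RHS](@mean_deriv _ (`|cplx_of_real t * r| * B') (fun w => f (u t w))
    (fun w => cplx_of_real t * r * kderive f (u t w))).
  - by apply: mean_eq => w _; ring.
  - by move=> w w1; rewrite normrM ler_wpM2l // B'_ge.
  move=> e' e'0; have etr0 : 0 < e' / `|cplx_of_real t * r|.
    by rewrite divr_gt0 ?normr_gt0.
  have [d' d'0 d'P] := unif_diff hf etr0.
  exists (d' / `|cplx_of_real t * r|); first by rewrite divr_gt0 ?normr_gt0.
  move=> x y x1 y1; rewrite ltr_pdivlMr ?normr_gt0 // mulrC -normrM => yx.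
  have uyx : u t y - u t x = cplx_of_real t * r * (y - x) by rewrite /u /W; ring.
  have := d'P (u t x) (u t y) (u_in _ _ t01 x1).
  have nE : e' / `|cplx_of_real t * r| * `|cplx_of_real t * r * (y - x)| = e' * `|y - x|.
    by rewrite [`|_ * (y - x)|]normrM mulrA divfK ?normr_eq0.
  rewrite uyx nE => /(_ yx).
  by congr (`|_| <= _); ring.
have errb : circle_bounded (e * `|T|)
    (fun w => f (u t' w) * k w - f (u t w) * k w - T * r * (kderive f (u t w) * w)).
  move=> w w1; have := dP _ _ (u_in _ _ t01 w1) (u_close w w1).
  rewrite uE => bnd.
  rewrite (_ : _ - _ = (f (u t' w) - f (u t w) - kderive f (u t w) * (T * (W w - z))) * k w).
    rewrite normrM; apply: le_trans (ler_wpM2r (normr_ge0 _) bnd) _.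
    rewrite /k !normrM normfV w1 mulr1 (gtr0_norm r0).
    have D0 : `|W w - z| != 0 by rewrite normr_eq0 nz.
    have r_neq0 : r != 0 by rewrite gt_eqF.
    move: D0; move: `|W w - z| `|T| => D S D0.
    rewrite [leLHS](_ : _ = e * S) //; field.
    by rewrite D0 r_neq0.
  rewrite /k; have := nz w w1; move: (W w - z) => q q0.
  by field.
have derb : circle_bounded B' (fun w => kderive f (u t w) * w).
  by move=> w w1; rewrite normrM w1 mulr1 B'_ge.
have := mean_le errb.
rewrite (meanB (M := B * (r / rho) + B * (r / rho)) (M' := `|T * r| * B')).
- rewrite (meanB (Fb _ t'01) (Fb _ t01)) (meanZ _ derb) main mulr0 subr0.
  by [].
- move=> w w1; rewrite (le_trans (ler_normB _ _)) // lerD //.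
    exact: Fb t'01 _ w1.
  exact: Fb t01 _ w1.
by move=> w w1; rewrite normrM ler_wpM2l // derb.
Qed.

Lemma mean_value_property f c r : 0 < r -> (forall x, `|x - c| <= r -> hol f x) ->
  mean (fun w => f (c + r * w)) = f c.
Proof.
move=> r0 hf; have := cauchy_homotopy hf (z := c).
rewrite subrr normr0 => /(_ r0).
have E w : `|w| = 1 -> r * w / (c + r * w - c) = 1.
  move=> w1; have w0 : w != 0 by rewrite -normr_gt0 w1.
  by rewrite addrC addKr divff // mulf_neq0 // gt_eqF.
rewrite (mean_eq (h := fun w => f (c + r * w))); last by move=> w /E ->; rewrite mulr1.
by move=> ->; rewrite (mean_eq E) mean_cst mulr1.
Qed.

(** On the unit circle the conjugate of the kernel is [r / (r - a * w)], with [a] the conjugate of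
    [z - c]. This is holomorphic on the closed unit disc because [|a| < r], so its mean is its value
    1 at the centre. *)
Lemma mean_cauchy_kernel c r z : `|z - c| < r ->
  mean (fun w => r * w / (c + r * w - z)) = 1.
Proof.
move=> zr; have r0 : 0 < r by exact: le_lt_trans zr.
pose a := (z - c)^*; have a_lt : `|a| < r by rewrite norm_conjC.
have nz x : `|x| <= 1 -> r - a * x != 0.
  move=> x1; rewrite subr_eq0; apply/eqP => rE.
  have : `|r| <= `|a| by rewrite rE normrM ler_piMr.
  by rewrite gtr0_norm // => /(lt_le_trans a_lt); rewrite ltxx.
have gE : mean (fun w => r * (r - a * (0 + 1 * w))^-1) = 1.
  rewrite (@mean_value_property (fun x => r * (r - a * x)^-1) 0 1 ltr01).
    by rewrite mulr0 subr0 divff ?gt_eqF.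
  move=> x; rewrite subr0 => x1; apply: holM; first exact: hol_cst.
  apply: (@holV _ (fun x => r - a * x)); last exact: nz.
  apply: holB; first exact: hol_cst.
  by apply: holM; [exact: hol_cst | exact: hol_id].
have kb : circle_bounded (r / (r - `|z - c|)) (fun w => r * w / (c + r * w - z)).
  move=> w w1; rewrite !normrM w1 mulr1 gtr0_norm // ler_pM2l // normfV.
  rewrite lef_pV2 ?posrE ?normr_gt0 ?circle_dist_neq0 ?subr_gt0 //.
  exact: circle_dist_ge.
rewrite -[LHS]conjCK -(mean_conj kb) -[RHS](rmorph1 (@Num.conj (Cplx R))) -gE.
congr (_^*)%R; apply: mean_eq => w w1; rewrite add0r mul1r.
have wb : w * w^* = 1 by rewrite -normCK w1 expr1n.
have cr : r^* = r by rewrite conj_Creal // gtr0_real.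
have nz2 : (c + r * w - z)^* != 0 by rewrite conjC_eq0 circle_dist_neq0.
rewrite rmorphM fmorphV; apply/eqP; rewrite eqr_div // ?nz ?w1 //; apply/eqP.
rewrite !rmorphM !rmorphB !rmorphD !rmorphM /= cr.
rewrite (_ : r * w^* * (r - a * w) = r * (r * w^*) - r * a * (w * w^*)); last by ring.
by rewrite wb /a rmorphB /=; ring.
Qed.

Lemma cauchy_formula f c r z : (forall x, `|x - c| <= r -> hol f x) -> `|z - c| < r ->
  mean (fun w => f (c + r * w) * (r * w / (c + r * w - z))) = f z.
Proof. by move=> hf zr; rewrite cauchy_homotopy // mean_cauchy_kernel // mulr1. Qed.

End CauchyFormula.

(** * Cauchy transforms and divided differences *)

Section CauchyTransform.
Variable R : realType.
Implicit Types (a c x y z w : Cplx R) (r e d M : Cplx R) (f g phi : Cplx R -> Cplx R).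

(** The Cauchy integral of a density over the circle of centre [c] and radius [r], with the factor
    from the contour element left inside [phi]. Differentiating in [z] only raises [m], so a merely
    bounded density gives all derivatives. *)
Definition transform phi c r (m : nat) z :=
  mean (fun w => phi w * (c + r * w - z) ^- m).

(** Second-order Taylor bound for an inverse power: [u] and [v] are the inverses of [W - y] and
    [W - z], and [h = y - z]. *)
Lemma inv_power_expansion (k h u v : Cplx R) m : `|u| <= k -> `|v| <= k ->
  u - v = h * u * v ->
  `|u ^+ m - v ^+ m - m%:R * h * v ^+ m.+1|
     <= (\sum_(i < m) i.+1%:R * k ^+ m.+2) * `|h| ^+ 2.
Proof.
move=> uk vk uv; have k0 : 0 <= k by exact: le_trans uk.
elim: m => [|m IH].
  by rewrite !expr0 subrr !mul0r subrr normr0 big_ord0 mul0r.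
set e := _ - _ - _ in IH.
have d0 : u - v - h * u * v = 0 by rewrite uv subrr.
(* The last summand is 0 by [d0]; it is kept so that the equality is a ring identity. *)
rewrite (_ : _ - _ - _ = u * e + m.+1%:R * (u * v ^+ m.+2) * h ^+ 2 +
  (u - v - h * u * v) * (v ^+ m + m.+1%:R * h * v ^+ m.+1)); last first.
  by rewrite /e !exprS -natr1; ring.
rewrite d0 mul0r addr0.
rewrite (le_trans (ler_normD _ _)) // big_ord_recr /= mulrDl lerD //.
  rewrite normrM; apply: le_trans (ler_pM _ _ uk IH) _ => //.
  rewrite mulrA ler_wpM2r ?exprn_ge0 // mulr_sumr ler_sum // => i _.
  by rewrite mulrCA -exprS.
rewrite normrM [`|_ * (u * _)|]normrM [`|u * _|]normrM normr_nat !normrX.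
rewrite ler_wpM2r ?exprn_ge0 // ler_wpM2l // [k ^+ _]exprS ler_pM ?exprn_ge0 //.
by rewrite lerXn2r // nnegrE.
Qed.

Lemma transform_is_derive phi c r M m z : circle_bounded M phi -> `|z - c| < r ->
  is_derive z 1 (transform phi c r m) (m%:R * transform phi c r m.+1 z).
Proof.
move=> phiM zr; have r0 : 0 < r := le_lt_trans (normr_ge0 _) zr.
(* Half the distance from [z] to the circle: every [y] within [rho] of [z] still has distance at
   least [rho] from it. *)
pose rho := (r - `|z - c|) / 2.
have rho0 : 0 < rho by rewrite divr_gt0 // subr_gt0.
have M0 : 0 <= M by apply: le_trans (phiM 1 (normr1 _)).
have inv_le y w : `|y - z| < rho -> `|w| = 1 -> `|(c + r * w - y)^-1| <= rho^-1.
  move=> yz w1; have ge_rho : rho <= `|c + r * w - y|.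
    apply: le_trans (circle_dist_ge c y r0 w1).
    rewrite lerBrDl; apply: le_trans (_ : (`|y - z| + `|z - c|) + rho <= _).
      by rewrite lerD2r -(subrKA z y) ler_normD.
    rewrite addrAC; apply: le_trans (_ : rho + rho + `|z - c| <= _).
      by rewrite lerD2r lerD2r ltW.
    by rewrite /rho -splitr subrK.
  rewrite normfV lef_pV2 ?posrE //; exact: lt_le_trans ge_rho.
have nz y w : `|y - z| < rho -> `|w| = 1 -> c + r * w - y != 0.
  move=> yz w1; apply: circle_dist_neq0 w1.
  rewrite -(subrKA z y) (le_lt_trans (ler_normD _ _)) //.
  apply: lt_trans (_ : rho + `|z - c| < r); first by rewrite ltrD2r.
  rewrite -ltrBrDr /rho ltr_pdivrMr // ltr_pMr ?subr_gt0 // ltr1n //.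
have bnd n y : `|y - z| < rho ->
    circle_bounded (M * rho ^- n) (fun w => phi w * (c + r * w - y) ^- n).
  move=> yz w w1; rewrite normrM ler_pM ?phiM // -exprVn normrX -exprVn.
  by rewrite lerXn2r ?nnegrE ?invr_ge0 ?(ltW rho0) // inv_le.
have zz : `|z - z| < rho by rewrite subrr normr0.
pose C := \sum_(i < m) i.+1%:R * rho^-1 ^+ m.+2.
have C0 : 0 <= C.
  by apply: sumr_ge0 => i _; rewrite mulr_ge0 ?exprn_ge0 ?invr_ge0 ?ltW.
apply: bound_is_derive => e e0.
have MC0 : 0 < M * C + 1 by rewrite ltr_wpDl ?mulr_ge0.
have eMC : 0 < e / (M * C + 1) by rewrite divr_gt0.
have N1 : \forall y \near z, `|y - z| < rho by apply/near_distP; exists rho.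
have N2 : \forall y \near z, `|y - z| < e / (M * C + 1).
  by apply/near_distP; exists (e / (M * C + 1)).
apply: filterS2 N1 N2 => y yz ye.
have -> : transform phi c r m y - transform phi c r m z
    - m%:R * transform phi c r m.+1 z * (y - z) =
  mean (fun w => (phi w * (c + r * w - y) ^- m - phi w * (c + r * w - z) ^- m)
     - (m%:R * (y - z)) * (phi w * (c + r * w - z) ^- m.+1)).
  rewrite (meanB (M := M * rho ^- m + M * rho ^- m)
    (M' := `|m%:R * (y - z)| * (M * rho ^- m.+1))).
  - rewrite (meanB (bnd m y yz) (bnd m z zz)) (meanZ _ (bnd m.+1 z zz)).
    by rewrite [m%:R * _ * (y - z)]mulrAC.
  - move=> w w1; rewrite (le_trans (ler_normB _ _)) // lerD //.
      exact: bnd m y yz w w1.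
    exact: bnd m z zz w w1.
  - move=> w w1; rewrite normrM ler_wpM2l //; exact: bnd m.+1 z zz w w1.
apply: (@le_trans _ _ (M * (C * `|y - z| ^+ 2))).
  apply: mean_le => w w1; set u := (c + r * w - y)^-1; set v := (c + r * w - z)^-1.
  have uv : u - v = (y - z) * u * v.
    rewrite /u /v; have := nz y w yz w1; have := nz z w zz w1.
    have -> : y - z = (c + r * w - z) - (c + r * w - y) by ring.
    move: (c + r * w - z) (c + r * w - y) => p q p0 q0.
    by field; rewrite p0 q0.
  rewrite -!exprVn -/u -/v.
  rewrite [X in `|X|](_ : _ = phi w * (u ^+ m - v ^+ m - m%:R * (y - z) * v ^+ m.+1)); last by ring.
  rewrite normrM ler_pM ?phiM //.
  by apply: inv_power_expansion => //; exact: inv_le.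
rewrite expr2 !mulrA ler_wpM2r //.
have : (M * C + 1) * `|y - z| <= e by rewrite mulrC -ler_pdivlMr // ltW.
by apply: le_trans; rewrite ler_wpM2r // lerDl.
Qed.

Lemma transform_hol phi c r M m z : circle_bounded M phi -> `|z - c| < r ->
  hol (transform phi c r m) z.
Proof.
move=> phiM zr; have d0 : 0 < r - `|z - c| by rewrite subr_gt0.
have near_r : \forall w \near z, `|w - c| < r.
  apply/near_distP; exists (r - `|z - c|) => // w.
  by rewrite ltrBrDr => /(le_lt_trans (_ : _)); apply; rewrite -(subrKA z w) ler_normD.
apply: (@hol_intro _ _ (fun w => m%:R * transform phi c r m.+1 w));
  apply: filterS near_r => w wr.
  exact: transform_is_derive phiM wr.
have [dT _] := transform_is_derive m.+1 phiM wr.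
apply: (@continuousM _ _ (fun=> m%:R) (transform phi c r m.+1)).
  exact: (@cst_continuous _ _ (m%:R : Cplx R) w).
exact: derivable_continuous.
Qed.

Lemma cauchy_transform f c r z : (forall x, `|x - c| <= r -> hol f x) -> `|z - c| < r ->
  f z = transform (fun w => f (c + r * w) * (r * w)) c r 1 z.
Proof.
move=> hf zr; rewrite -{1}(cauchy_formula hf zr); apply: mean_eq => w _.
by rewrite expr1 mulrA.
Qed.

Lemma cauchy_density_bounded f c r M : 0 < r -> (forall x, `|x - c| <= r -> `|f x| <= M) ->
  circle_bounded (M * r) (fun w => f (c + r * w) * (r * w)).
Proof.
move=> r0 fM w w1; rewrite !normrM w1 mulr1 (gtr0_norm r0) ler_pM2r // fM //.
by rewrite addrC addKr normrM w1 mulr1 gtr0_norm.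
Qed.

Lemma hol_cball f z : hol f z ->
  exists2 r, 0 < r & forall x, `|x - z| <= r -> hol f x.
Proof.
move=> /hol_near/near_dist[d d0 dP]; exists (d / 2); first by rewrite divr_gt0.
move=> x xd; apply: dP; apply: le_lt_trans xd _.
by rewrite ltr_pdivrMr // ltr_pMr // ltr1n.
Qed.

(** Here C^1 becomes infinitely differentiable: near [z] the function is a Cauchy transform of order
    1, its derivative the one of order 2, again holomorphic. *)
Lemma hol_kderive f z : hol f z -> hol (kderive f) z.
Proof.
move=> /hol_cball[r r0 hf].
have [M fM] := cball_bounded (fun x xr => hol_continuous (hf x xr)).
have phiM := cauchy_density_bounded r0 fM.
set phi := (fun w => _) in phiM.
have zr : `|z - z| < r by rewrite subrr normr0.
have near_r : \forall w \near z, `|w - z| < r by apply/near_distP; exists r.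
apply: hol_near_eq (transform_hol 2 phiM zr).
apply: filterS (near_near near_r) => w wr; apply/esym/is_derive_kderive.
rewrite -[transform _ _ _ _ _]mul1r.
apply: near_eq_is_derive (transform_is_derive 1 phiM (nbhs_singleton wr)).
by apply: filterS wr => x xr; rewrite -cauchy_transform.
Qed.

Definition divdiff a f z : Cplx R :=
  if z == a then kderive f a else (f z - f a) / (z - a).

Lemma divdiffE a f z : f z = f a + (z - a) * divdiff a f z.
Proof.
rewrite /divdiff; case: eqVneq => [->|za]; first by rewrite subrr mul0r addr0.
by rewrite mulrCA divff ?mulr1 ?subr_eq0 // addrC subrK.
Qed.

(** The integrand is regular at [z = a], so one formula covers distinct points (partial fractions)
    and the confluent case (the derivative, a transform of order 2). *)
Lemma divdiff_mean f c r a z : (forall x, `|x - c| <= r -> hol f x) ->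
  `|a - c| < r -> `|z - c| < r ->
  divdiff a f z =
    mean (fun w => f (c + r * w) * (r * w) / ((c + r * w - a) * (c + r * w - z))).
Proof.
move=> hf ar zr; have r0 : 0 < r := le_lt_trans (normr_ge0 _) zr.
have [M fM] := cball_bounded (fun x xr => hol_continuous (hf x xr)).
have phiM := cauchy_density_bounded r0 fM.
have M0 : 0 <= M by apply: le_trans (fM c _); rewrite // subrr normr0 ltW.
set phi := (fun w => _) in phiM.
have inv_le y w : `|y - c| < r -> `|w| = 1 -> `|(c + r * w - y)^-1| <= (r - `|y - c|)^-1.
  move=> yr w1; rewrite normfV lef_pV2 ?posrE ?normr_gt0 ?subr_gt0 ?circle_dist_neq0 //.
  exact: circle_dist_ge.
rewrite /divdiff; case: eqVneq => [->|za].
  have near_r : \forall w \near a, `|w - c| < r.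
    apply/near_distP; exists (r - `|a - c|); rewrite ?subr_gt0 // => w.
    by rewrite ltrBrDr => /(le_lt_trans (_ : _)); apply; rewrite -(subrKA a w) ler_normD.
  transitivity (1%:R * transform phi c r 2 a).
    apply: is_derive_kderive.
    apply: near_eq_is_derive (transform_is_derive 1 phiM ar).
    by apply: filterS near_r => x xr; rewrite -cauchy_transform.
  by rewrite mul1r; apply: mean_eq => w _; rewrite expr2.
have fE y : `|y - c| < r -> circle_bounded (M * r * (r - `|y - c|)^-1)
    (fun w => phi w * (c + r * w - y) ^- 1).
  by move=> yr w w1; rewrite expr1 normrM ler_pM // ?phiM // inv_le.
rewrite (cauchy_transform hf ar) (cauchy_transform hf zr) -(meanB (fE _ zr) (fE _ ar)).
rewrite mulrC -(meanZ (M := M * r * (r - `|z - c|)^-1 + M * r * (r - `|a - c|)^-1)); last first.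
  move=> w w1; rewrite (le_trans (ler_normB _ _)) // lerD //.
    exact: fE zr w w1.
  exact: fE ar w w1.
apply: mean_eq => w w1; rewrite !expr1 -/(phi w).
have := circle_dist_neq0 zr w1; have := circle_dist_neq0 ar w1.
have za0 : z - a != 0 by rewrite subr_eq0.
have E : z - a = (c + r * w - a) - (c + r * w - z) by ring.
move: za0; rewrite E; move: (c + r * w - a) (c + r * w - z) (phi w) => p q s pq p0 q0.
by field; rewrite p0 q0 pq.
Qed.

Lemma divdiff_hol a f z : hol f a -> hol f z -> hol (divdiff a f) z.
Proof.
move=> ha hz; have [->|za] := eqVneq z a; last first.
  have near_a : \forall w \near z, w != a.
    apply/near_distP; exists `|z - a|; first by rewrite normr_gt0 subr_eq0.
    by move=> w; apply: contraTneq => ->; rewrite distrC ltxx.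
  apply: (@hol_near_eq _ (fun w => (f w - f a) * (w - a)^-1)).
    by apply: filterS near_a => w wa; rewrite /divdiff (negPf wa).
  apply: (@holM _ (fun w => f w - f a) (fun w => (w - a)^-1)).
    exact: (holB hz (hol_cst (f a) z)).
  apply: (@holV _ (fun w => w - a)); last by rewrite subr_eq0.
  exact: (holB (hol_id z) (hol_cst a z)).
have [r r0 hf] := hol_cball ha.
have [M fM] := cball_bounded (fun x xr => hol_continuous (hf x xr)).
have phiM := cauchy_density_bounded r0 fM.
have ar : `|a - a| < r by rewrite subrr normr0.
have near_r : \forall w \near a, `|w - a| < r by apply/near_distP; exists r.
(* For the fixed node [a], the factor [1 / (W - a)] joins the density, and a transform of order 1
   remains. *)
apply: (@hol_near_eq _ (transform (fun w => f (a + r * w) * (r * w) / (a + r * w - a)) a r 1)).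
  apply: filterS near_r => y yr; rewrite (divdiff_mean hf ar yr); apply: mean_eq => w _.
  by rewrite expr1 [in RHS]invfM [RHS]mulrA.
apply: (@transform_hol _ _ _ (M * r * r^-1)) => // w w1.
rewrite normrM ler_pM ?phiM // addrC addKr normfV normrM w1 mulr1 gtr0_norm //.
Qed.

(** If [|z - a| >= d / 2], the quotient is at most [2 C / (d / 2)]. Otherwise the mean over the
    circle of radius [d] about [a] gives [2 C / d], however close [z] is to [a]. *)
Lemma divdiff_bound f a z d (C : Cplx R) : 0 < d -> (forall x, `|x - a| <= d -> hol f x) ->
  (forall x, `|x - a| <= d -> `|f x| <= C) -> `|f z| <= C ->
  `|divdiff a f z| <= 4 * C / d.
Proof.
move=> d0 hf fC fz; have C0 : 0 <= C by exact: le_trans fz.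
have d20 : 0 < d / 2 by rewrite divr_gt0.
have [ge|lt] := real_leP (gtr0_real d20) (normr_real (z - a)).
  have za : z != a by rewrite -subr_eq0 -normr_gt0; exact: lt_le_trans ge.
  rewrite /divdiff (negPf za) normrM normfV.
  apply: le_trans (_ : (C + C) * (d / 2)^-1 <= _).
    rewrite ler_pM // ?invr_ge0 //; last by rewrite lef_pV2 ?posrE // normr_gt0 subr_eq0.
    rewrite (le_trans (ler_normB _ _)) // lerD // fC // subrr normr0 ltW //.
  by rewrite le_eqVlt; apply/orP; left; apply/eqP; field; rewrite gt_eqF.
have zd : `|z - a| < d by apply: lt_trans lt _; rewrite ltr_pdivrMr // ltr_pMr // ltr1n.
have ad : `|a - a| < d by rewrite subrr normr0.
rewrite (divdiff_mean hf ad zd); apply: (@le_trans _ _ (C * (d / 2)^-1)).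
  apply: mean_le => w w1.
  have w0 : w != 0 by rewrite -normr_gt0 w1.
  have dw0 : d * w != 0 by rewrite mulf_neq0 // gt_eqF.
  rewrite (_ : a + d * w - a = d * w); last by ring.
  rewrite invfM [X in `|X|]mulrA mulfK // normrM normfV ler_pM // ?invr_ge0 //.
    by apply: fC; rewrite addrC addKr normrM w1 mulr1 gtr0_norm.
  rewrite lef_pV2 ?posrE ?normr_gt0 ?circle_dist_neq0 //.
  apply: le_trans (circle_dist_ge _ _ _ w1) => //.
  by rewrite lerBrDr [leRHS]splitr lerD2l ltW.
rewrite [leLHS](_ : _ = 2 * C / d); last by field; rewrite gt_eqF.
by rewrite ler_wpM2r ?invr_ge0 ?(ltW d0) // ler_wpM2r // ler_nat.
Qed.

End CauchyTransform.

(** * Newton interpolation and matrix functions *)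

Section MatrixPolynomial.
Variable C : fieldType.
Implicit Types (p q : {poly C}).

(* [horner_mx] for matrices of any size, including 0. *)
Definition mxeval n : 'M[C]_n -> {poly C} -> 'M[C]_n :=
  if n is n'.+1 then fun A p => horner_mx A p else fun _ _ => 0.

Lemma mxevalD n (A : 'M[C]_n) p q : mxeval A (p + q) = mxeval A p + mxeval A q.
Proof. by case: n A => [|n] A /=; rewrite ?addr0 ?rmorphD. Qed.

Lemma mxevalM n (A : 'M[C]_n) p q : mxeval A (p * q) = mxeval A p *m mxeval A q.
Proof. by case: n A => [|n] A /=; rewrite ?mul0mx ?rmorphM. Qed.

Lemma mxevalC n (A : 'M[C]_n) c : mxeval A c%:P = c%:M.
Proof. by case: n A => [|n] A /=; rewrite ?horner_mx_C // [RHS]flatmx0. Qed.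

Lemma mxevalX n (A : 'M[C]_n) : mxeval A 'X = A.
Proof. by case: n A => [|n] A /=; rewrite ?horner_mx_X // [RHS]flatmx0. Qed.

Lemma mxeval0 n (A : 'M[C]_n) : mxeval A 0 = 0.
Proof. by case: n A => [|n] A //=; rewrite rmorph0. Qed.

Lemma mxeval_MXaddC n (A : 'M[C]_n) p c :
  mxeval A (p * 'X + c%:P) = mxeval A p *m A + c%:M.
Proof. by rewrite mxevalD mxevalM mxevalX mxevalC. Qed.

Lemma mxeval_char_poly n (A : 'M[C]_n) : mxeval A (char_poly A) = 0.
Proof. by case: n A => [|n] A //=; exact: Cayley_Hamilton. Qed.

(** A rectangular [X] lets this serve similarities, eigenvectors (as intertwiners with a matrix of
    size 1) and the block identity behind [matfun_sub]. *)
Lemma mxeval_intertwine m n (A : 'M[C]_m) (B : 'M[C]_n) (X : 'M[C]_(m, n)) p :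
  A *m X = X *m B -> mxeval A p *m X = X *m mxeval B p.
Proof.
move=> AX; elim/poly_ind: p => [|p c IH]; first by rewrite !mxeval0 mul0mx mulmx0.
rewrite !mxeval_MXaddC mulmxDl mulmxDr -mulmxA AX !mulmxA IH.
by rewrite mul_scalar_mx mul_mx_scalar.
Qed.

Lemma mxeval_similar m n (A : 'M[C]_m) (B : 'M[C]_n) (X : 'M[C]_(m, n))
    (Y : 'M[C]_(n, m)) p :
  X *m Y = 1%:M -> Y *m X = 1%:M -> A = X *m B *m Y -> mxeval A p = X *m mxeval B p *m Y.
Proof.
move=> XY YX AE; rewrite -(mxeval_intertwine (A := A)).
  by rewrite -mulmxA XY mulmx1.
by rewrite AE -mulmxA YX mulmx1.
Qed.

Lemma mul_mxdiag k (s : 'I_k -> nat) (A B : forall i, 'M[C]_(s i)) :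
  \mxdiag_i A i *m \mxdiag_i B i = \mxdiag_i (A i *m B i).
Proof.
rewrite [in X in _ *m X]/mxdiag mul_mxdiag_mxblock; apply/eq_mxblock => i j.
case: eqVneq => [ij|_]; last by rewrite mulmx0.
by move: ij => <-; rewrite !conform_mx_id.
Qed.

Lemma mxeval_mxdiag k (s : 'I_k -> nat) (A : forall i, 'M[C]_(s i)) p :
  mxeval (\mxdiag_i A i) p = \mxdiag_i mxeval (A i) p.
Proof.
elim/poly_ind: p => [|p c IH].
  by rewrite mxeval0; under eq_mxdiag do rewrite mxeval0; rewrite mxdiag0.
rewrite mxeval_MXaddC IH mul_mxdiag -mxdiagZ -mxdiagD.
by apply/eq_mxdiag => i; rewrite mxeval_MXaddC.
Qed.

End MatrixPolynomial.

Section JordanBlockPolynomial.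
Variable R : realType.

Lemma mxeval_jordan_block s (a : Cplx R) p : mxeval (jordan_block s a) p =
  \matrix_(i, j) (if (i <= j)%N then (p^`N(j - i)).[a] else 0).
Proof.
elim/poly_ind: p => [|p c IH].
  rewrite mxeval0; apply/matrixP => i j; rewrite !mxE.
  by rewrite raddf0 horner0 if_same.
rewrite mxeval_MXaddC IH; apply/matrixP => i j; rewrite !mxE.
pose x (l : nat) := if (i <= l)%N then (p^`N(l - i)).[a] else 0.
transitivity (x j * a + (if j : nat is j'.+1 then x j' else 0) + c *+ (i == j)).
  congr (_ + _); rewrite -(sum_jordan_col a x j).
  by apply: eq_bigr => l _; rewrite !mxE.
rewrite /x; case: ltngtP => [lt_ij|gt_ij|/val_inj ->].
- rewrite -(subnSK lt_ij) nderivnMXaddC !hornerE /=.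
  case: j lt_ij => -[|j] ltj //= lt_ij; rewrite subSS.
  rewrite -ltnS lt_ij -val_eqE /= ltn_eqF // addr0 addrC; congr (_ + _).
- rewrite mul0r add0r -val_eqE /= gtn_eqF // addr0.
  case: j gt_ij => -[|j] ltj //= gt_ij.
  by rewrite leqNgt (ltnW gt_ij).
- rewrite subnn !nderivn0 hornerMXaddC eqxx; case: (j) => -[|j'] lt_j' /=; first by rewrite addr0.
  by rewrite ltnn addr0.
Qed.

End JordanBlockPolynomial.

Opaque hol.

(** * Iterated derivatives of sums, products and polynomials *)

Section IteratedDerivatives.
Variable R : realType.
Implicit Types (f g h : Cplx R -> Cplx R) (a z : Cplx R) (p : {poly Cplx R}).

Lemma kderive_near_eq f g z : (\forall w \near z, f w = g w) ->
  \forall w \near z, kderive f w = kderive g w.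
Proof.
move=> /near_near; apply: filterS => w fg.
by rewrite /kderive !derive1E; exact: near_eq_derive.
Qed.

Lemma derive1n_near_eq j f g z : (\forall w \near z, f w = g w) ->
  \forall w \near z, derive1n j f w = derive1n j g w.
Proof.
move=> fg; elim: j => [|j IH] //.
by rewrite !derive1nS; exact: kderive_near_eq IH.
Qed.

Lemma hol_derive1n j f z : hol f z -> hol (derive1n j f) z.
Proof.
move=> hf; elim: j => [|j IH]; first exact: hf.
by rewrite derive1nS; exact: hol_kderive IH.
Qed.

Lemma hol_times_derivable j f z : hol f z -> times_derivable j f z.
Proof.
elim: j z => [|j IH] z hf //=; split.
  by apply: filterS (hol_near hf) => w; exact: IH.
exact: hol_derivable (hol_derive1n j hf).
Qed.

Lemma kderiveD f g z : hol f z -> hol g z ->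
  kderive (fun w => f w + g w) z = kderive f z + kderive g z.
Proof.
move=> hf hg; apply: is_derive_kderive; apply: (@is_deriveD _ _ _ f g);
  apply: derivable_is_derive; exact: hol_derivable.
Qed.

Lemma kderiveM f g z : hol f z -> hol g z ->
  kderive (fun w => f w * g w) z = kderive f z * g z + f z * kderive g z.
Proof.
move=> hf hg; rewrite addrC [kderive f z * _]mulrC; apply: is_derive_kderive; apply: (@is_deriveM _ _ f g);
  apply: derivable_is_derive; exact: hol_derivable.
Qed.

Lemma derive1nD j f g z : hol f z -> hol g z ->
  derive1n j (fun w => f w + g w) z = derive1n j f z + derive1n j g z.
Proof.
elim: j f g => [|j IH] f g hf hg; first by rewrite !derive1n0.
rewrite !derive1Sn.
rewrite -(IH (kderive f) (kderive g)); [|exact: hol_kderive|exact: hol_kderive].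
have E : \forall w \near z,
    kderive (fun w => f w + g w) w = kderive f w + kderive g w.
  by apply: filterS2 (hol_near hf) (hol_near hg) => w ? ?; exact: kderiveD.
exact: (nbhs_singleton (derive1n_near_eq j E)).
Qed.

(** A zero of order [s] survives multiplication. Induction on [s] through [g' h + g h'], whose two
    terms vanish to order [s - 1], takes the place of Leibniz's formula. *)
Lemma derive1n_mul_eq0 s g h a : hol g a -> hol h a ->
  (forall i, (i < s)%N -> derive1n i g a = 0) ->
  forall i, (i < s)%N -> derive1n i (fun w => g w * h w) a = 0.
Proof.
elim: s g h => [|s IH] g h hg hh g0 // [_|i lt_is].
  by have := g0 0%N isT; rewrite !derive1n0 => ->; rewrite mul0r.
rewrite derive1Sn.
have hg' := hol_kderive hg; have hh' := hol_kderive hh.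
have E : \forall w \near a,
    kderive (fun w => g w * h w) w = kderive g w * h w + g w * kderive h w.
  by apply: filterS2 (hol_near hg) (hol_near hh) => w ? ?; exact: kderiveM.
apply: etrans (nbhs_singleton (derive1n_near_eq i E)) _.
rewrite (derive1nD i (holM hg' hh) (holM hg hh')).
rewrite (IH _ _ hg' hh) ?(IH _ _ hg hh') ?addr0 //.
- by move=> j lt_js; apply: g0; exact: ltnW.
- move=> j lt_js; have := g0 j.+1 lt_js; by rewrite derive1Sn.
Qed.

Lemma hol_horner p z : hol (horner p) z.
Proof.
elim/poly_ind: p => [|p c IH].
  by apply: hol_near_eq (hol_cst 0 z); apply: near_all => w; rewrite horner0.
apply: hol_near_eq (holD (holM IH (hol_id z)) (hol_cst c z)).
by apply: near_all => w; rewrite !hornerE.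
Qed.

Lemma kderive_horner p z : kderive (horner p) z = (p^`()).[z].
Proof.
elim/poly_ind: p z => [|p c IH] z.
  rewrite deriv0 horner0 (_ : horner 0 = fun=> 0); last by apply: funext => w; rewrite horner0.
  by apply: is_derive_kderive; exact: is_derive_cst.
rewrite (_ : horner (p * 'X + c%:P) = fun w => p.[w] * w + c); last first.
  by apply: funext => w; rewrite !hornerE.
rewrite (kderiveD (holM (hol_horner p z) (hol_id z)) (hol_cst c z)).
rewrite (kderiveM (hol_horner p z) (hol_id z)) IH.
rewrite (_ : kderive id z = 1); last by apply: is_derive_kderive; exact: is_derive_id.
rewrite (_ : kderive (fun=> c) z = 0); last first.
  by apply: is_derive_kderive; exact: is_derive_cst.
by rewrite derivMXaddC !hornerE [RHS]addrC.
Qed.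

Lemma derive1n_horner j p z : derive1n j (horner p) z / j`!%:R = (p^`N(j)).[z].
Proof.
have -> : derive1n j (horner p) z = (p^`(j)).[z].
  elim: j p => [|j IH] p //; rewrite derive1Sn derivSn -IH.
  by congr (derive1n j _ z); apply: funext => w; exact: kderive_horner.
rewrite nderivn_def hornerMn -[_ *+ _]mulr_natr mulfK // pnatr_eq0 -lt0n.
exact: fact_gt0.
Qed.

End IteratedDerivatives.

(** * Matrix functions as Newton polynomials *)

Section MatrixFunction.
Variable R : realType.
Implicit Types (f : Cplx R -> Cplx R) (a z : Cplx R) (p : {poly Cplx R}) (rs : seq (Cplx R)).
Implicit Type Omega : set (Cplx R).

(** Nested form of Newton's polynomial. Repeated nodes give Hermite interpolation, as [divdiff a f]
    takes the value of the derivative at [a]. *)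
Fixpoint newton rs f : {poly Cplx R} :=
  if rs is a :: rs' then
    newton rs' (divdiff a f) * ('X - a%:P) + (f a)%:P
  else 0.

Fixpoint newton_rem rs f : Cplx R -> Cplx R :=
  if rs is a :: rs' then newton_rem rs' (divdiff a f) else f.

Lemma newtonE rs f z : f z =
  (\prod_(a <- rs) ('X - a%:P)).[z] * newton_rem rs f z + (newton rs f).[z].
Proof.
elim: rs f => [|a rs IH] f /=; first by rewrite big_nil horner0 hornerC mul1r addr0.
rewrite big_cons hornerM hornerXsubC hornerD hornerM hornerXsubC hornerC.
by rewrite {1}(divdiffE a f z) (IH (divdiff a f)); ring.
Qed.

Lemma newton_rem_hol Omega rs f :
  (forall z, Omega z -> hol f z) -> (forall a, a \in rs -> Omega a) ->
  forall z, Omega z -> hol (newton_rem rs f) z.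
Proof.
elim: rs f => [|a rs IH] f hf rsO z Oz; first exact: hf.
apply: IH Oz => [x Ox|b b_rs].
  by apply: divdiff_hol; apply: hf => //; apply: rsO; exact: mem_head.
by apply: rsO; rewrite in_cons b_rs orbT.
Qed.

Lemma jordan_decomp_eval n (A : 'M[Cplx R]_n) (D : jordan_decomp A) p :
  mxeval A p = jd_Z D *m (\mxdiag_l mxeval (jordan_block (jd_size D l) (jd_eig D l)) p)
                      *m jd_Zinv D.
Proof.
rewrite (mxeval_similar _ (jd_ZK D) (jd_KZ D) (jd_eq D)).
by rewrite mxeval_mxdiag.
Qed.

(** The first row of [q] at a Jordan block lists the Taylor coefficients of [q] at the eigenvalue,
    and all of them vanish. *)
Lemma annihilated_block n (A : 'M[Cplx R]_n) (D : jordan_decomp A) q l :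
  mxeval A q = 0 -> forall i, (i < jd_size D l)%N -> (q^`N(i)).[jd_eig D l] = 0.
Proof.
move=> qA i lt_i.
have diag0 : \mxdiag_l mxeval (jordan_block (jd_size D l) (jd_eig D l)) q = 0.
  have := jordan_decomp_eval D q; rewrite qA => /(congr1 (fun X => jd_Zinv D *m X *m jd_Z D)).
  by rewrite mulmx0 mul0mx !mulmxA jd_KZ mul1mx -mulmxA jd_KZ mulmx1.
have /eq_mxdiagP/(_ l) : \mxdiag_l mxeval (jordan_block (jd_size D l) (jd_eig D l)) q
  = \mxdiag_l (0 : 'M_(jd_size D l)) by rewrite diag0 mxdiag0.
rewrite mxeval_jordan_block => /matrixP /(_ (Ordinal (jd_size_gt0 l)) (Ordinal lt_i)).
by rewrite !mxE /= subn0.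
Qed.

(** In [newtonE] the product over [rs] vanishes to the order of each block, so [f] and its Newton
    polynomial have the same derivatives wherever a decomposition reads them. Allowing any
    annihilating product lets [A], [B] and a block matrix built from them share one polynomial. *)
Lemma is_matfunP Omega f rs n (A : 'M[Cplx R]_n) :
  (forall z, Omega z -> hol f z) -> (forall a, a \in rs -> Omega a) ->
  mxeval A (\prod_(a <- rs) ('X - a%:P)) = 0 ->
  forall B, is_matfun f A B <-> B = mxeval A (newton rs f).
Proof.
move=> hf rsO qA; set q := \prod_(a <- rs) _ in qA.
(* Each [jd_eig D l] is a root of the annihilating product, hence one of the nodes. *)
have hol_eig (D : jordan_decomp A) l : hol f (jd_eig D l) /\ Omega (jd_eig D l).
  suff Ol : Omega (jd_eig D l) by split=> //; exact: hf.
  have := annihilated_block qA (jd_size_gt0 l).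
  rewrite nderivn0 => /rootP; rewrite root_prod_XsubC; exact: rsO.
have blockE (D : jordan_decomp A) l : fun_jordan_block f (jd_size D l) (jd_eig D l) =
    mxeval (jordan_block (jd_size D l) (jd_eig D l)) (newton rs f).
  rewrite mxeval_jordan_block; apply/matrixP => i j; rewrite !mxE; case: leqP => // le_ij.
  have [hl Ol] := hol_eig D l; set a := jd_eig D l in hl Ol *.
  have lt_ji : (j - i < jd_size D l)%N by apply: leq_ltn_trans (ltn_ord j); exact: leq_subr.
  have hr := newton_rem_hol hf rsO Ol.
  rewrite -derive1n_horner; congr (_ / _).
  transitivity (derive1n (j - i) (fun w => q.[w] * newton_rem rs f w + (newton rs f).[w]) a).
    by congr (derive1n _ _ a); apply: funext => w; exact: newtonE.
  rewrite (derive1nD _ (holM (hol_horner q a) hr) (hol_horner _ a)).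
  rewrite (derive1n_mul_eq0 (s := jd_size D l) (hol_horner q a) hr) ?add0r // => k lt_k.
  have := annihilated_block qA lt_k; rewrite -/a -derive1n_horner => /eqP.
  by rewrite mulf_eq0 invr_eq0 pnatr_eq0 -leqn0 leqNgt fact_gt0 orbF => /eqP.
move=> B; split=> [[D [_ ->]]|->].
  rewrite (jordan_decomp_eval D); congr (_ *m _ *m _).
  by apply/eq_mxdiag => l; exact: blockE.
have [D] := jordan_decomp_exists A; exists D; split=> [l|].
  by apply: hol_times_derivable; have [] := hol_eig D l.
rewrite (jordan_decomp_eval D); congr (_ *m _ *m _).
by apply/eq_mxdiag => l; rewrite blockE.
Qed.

Lemma matfun_newton Omega f rs n (A : 'M[Cplx R]_n) :
  (forall z, Omega z -> hol f z) -> (forall a, a \in rs -> Omega a) ->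
  mxeval A (\prod_(a <- rs) ('X - a%:P)) = 0 ->
  matfun_defined f A /\ matfun f A = mxeval A (newton rs f).
Proof.
move=> hf rsO qA; have fA := is_matfunP hf rsO qA.
have ex : exists B, is_matfun f A B by exists (mxeval A (newton rs f)); apply/fA.
by split=> //; apply/fA; have [B fB] := ex; exact: xgetPex ex.
Qed.

Definition spectrum_in Omega n (A : 'M[Cplx R]_n) := forall a, eigenvalue A a -> Omega a.

Lemma char_poly_roots n (A : 'M[Cplx R]_n) :
  exists rs, [/\ char_poly A = \prod_(a <- rs) ('X - a%:P), size rs = n &
    forall a, (a \in rs) = eigenvalue A a].
Proof.
have [rs rsE] := closed_field_poly_normal (char_poly A).
rewrite (eqP (char_poly_monic A)) scale1r in rsE.
exists rs; split=> //; last first.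
  by move=> a; rewrite eigenvalue_root_char rsE root_prod_XsubC.
have := size_char_poly A; rewrite rsE size_prod_XsubC; by case.
Qed.

Lemma matfun_defined_spectrum Omega f n (A : 'M[Cplx R]_n) :
  (forall z, Omega z -> hol f z) -> spectrum_in Omega A -> matfun_defined f A.
Proof.
move=> hf AO; have [rs [rsE _ rs_eig]] := char_poly_roots A.
have rsO a : a \in rs -> Omega a by rewrite rs_eig; exact: AO.
by have [] := matfun_newton hf rsO (A := A); rewrite // -rsE mxeval_char_poly.
Qed.

End MatrixFunction.

Opaque kderive mean.

(** * Local boundedness *)

Section MatrixTopology.
Variable R : realType.

Lemma near_entries m n (A : 'M[Cplx R]_(m, n)) (e : Cplx R) : 0 < e ->
  \forall B \near A, forall i j, `|(B : 'M[Cplx R]_(m, n)) i j - A i j| < e.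
Proof.
move=> e0; apply/nbhs_ballP; exists e => // B [_ AB] i j.
by have := AB i j; rewrite /ball /= distrC.
Qed.

Lemma entry_le_norm m n (A : 'M[Cplx R]_(m, n)) i j : `|A i j| <= `|A|.
Proof.
apply/ler_addgt0Pr => e e0.
have : ball 0 (`|A| + e) A by rewrite -ball_normE /= sub0r normrN ltrDl.
by case=> _ /(_ i j); rewrite /ball /= mxE sub0r normrN => /ltW.
Qed.

Lemma norm_le_entries m n (A : 'M[Cplx R]_(m, n)) (e : Cplx R) :
  0 <= e -> (forall i j, `|A i j| <= e) -> `|A| <= e.
Proof.
move=> e0 Ae; apply/ler_addgt0Pr => d d0.
have : ball 0 (e + d) A.
  split=> [|i j]; first by rewrite ltr_wpDl.
  by rewrite /ball /= mxE sub0r normrN (le_lt_trans (Ae i j)) // ltrDl.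
by rewrite -ball_normE /= sub0r normrN => /ltW.
Qed.

Lemma continuous_mx (T : topologicalType) m n (F : T -> 'M[Cplx R]_(m, n)) (x : T) :
  (forall i j, {for x, continuous (fun t => F t i j)}) -> {for x, continuous F}.
Proof.
move=> cF; apply/cvgrPdist_lt => e e0.
have : \forall t \near x, forall ij : 'I_m * 'I_n, `|F x ij.1 ij.2 - F t ij.1 ij.2| < e.
  apply: filter_forall => ij.
  by apply: (@cvgr_dist_lt _ _ _ (nbhs x) _ (fun t => F t ij.1 ij.2)) => //; exact: cF.
apply: filterS => t Ft.
have : ball (F x) e (F t) by split=> // i j; exact: (Ft (i, j)).
by rewrite -ball_normE.
Qed.

Lemma continuous_entry (T : topologicalType) m n (F : T -> 'M[Cplx R]_(m, n)) (x : T) i j :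
  {for x, continuous F} -> {for x, continuous (fun t => F t i j)}.
Proof. by move=> cF; apply: (@cvg_comp _ _ _ F (fun M => M i j)) cF _; exact: coord_continuous. Qed.

Lemma continuous_sum (T : topologicalType) (I : Type) (r : seq I) (F : I -> T -> Cplx R)
    (x : T) : (forall i, {for x, continuous (F i)}) ->
  {for x, continuous (fun t => \sum_(i <- r) F i t)}.
Proof.
move=> cF; elim: r => [|i r IH].
  rewrite (_ : (fun t => _) = (fun=> 0)); last by apply: funext => t; rewrite big_nil.
  exact: (@cst_continuous _ _ (0 : Cplx R) x).
rewrite (_ : (fun t => _) = (fun t => F i t + \sum_(i <- r) F i t)); last first.
  by apply: funext => t; rewrite big_cons.
exact: (@continuousD _ _ _ (F i) (fun t => \sum_(i <- r) F i t) x (cF i) IH).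
Qed.

Lemma continuous_mulmx (T : topologicalType) m n p (F : T -> 'M[Cplx R]_(m, n))
    (G : T -> 'M[Cplx R]_(n, p)) (x : T) :
  {for x, continuous F} -> {for x, continuous G} ->
  {for x, continuous (fun t => F t *m G t)}.
Proof.
move=> cF cG; apply: continuous_mx => i j.
rewrite (_ : (fun t => _) = (fun t => \sum_k F t i k * G t k j)); last first.
  by apply: funext => t; rewrite mxE.
apply: continuous_sum => k.
have cFe := @continuous_entry _ _ _ F x i k cF.
have cGe := @continuous_entry _ _ _ G x k j cG.
exact: (cvgM cFe cGe).
Qed.

Lemma continuous_mxeval n (p : {poly Cplx R}) (A : 'M[Cplx R]_n) :
  {for A, continuous (fun B : 'M[Cplx R]_n => mxeval B p)}.
Proof.
elim/poly_ind: p => [|p c IH].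
  rewrite (_ : (fun B : 'M_n => _) = (fun=> 0)); last by apply: funext => B; rewrite mxeval0.
  exact: (@cst_continuous _ _ (0 : 'M[Cplx R]_n) A).
rewrite (_ : (fun B : 'M_n => _) = (fun B => mxeval B p *m B + c%:M)); last first.
  by apply: funext => B; rewrite mxeval_MXaddC.
have cid : {for A, continuous (id : 'M[Cplx R]_n -> 'M[Cplx R]_n)} by exact: cvg_id.
have cM := continuous_mulmx IH cid.
exact: (cvgD cM (@cvg_cst _ (c%:M : 'M[Cplx R]_n) _ (nbhs A) _)).
Qed.

Lemma ex_min_pos (r1 r2 : Cplx R) : 0 < r1 -> 0 < r2 ->
  exists r, [/\ 0 < r, r <= r1 & r <= r2].
Proof.
move=> r10 r20; have [le|lt] := real_leP (gtr0_real r10) (gtr0_real r20).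
  by exists r1.
by exists r2; split=> //; exact: ltW.
Qed.

Definition mx_bounded m n (M : Cplx R) (A : 'M[Cplx R]_(m, n)) :=
  forall i j, `|A i j| <= M.

Lemma mx_boundedM m n p (M N : Cplx R) (A : 'M[Cplx R]_(m, n)) (B : 'M[Cplx R]_(n, p)) :
  mx_bounded M A -> mx_bounded N B -> mx_bounded (n%:R * (M * N)) (A *m B).
Proof.
move=> AM BN i j; rewrite mxE (le_trans (ler_norm_sum _ _ _)) //.
apply: le_trans (ler_sum _ (G := fun=> M * N) _) _.
  by move=> k _; rewrite normrM ler_pM.
by rewrite sumr_const card_ord mulr_natl.
Qed.

End MatrixTopology.

(** * Perturbation of the spectrum and uniform bounds *)

Section Perturbation.
Variable R : realType.
Implicit Types (f g : Cplx R -> Cplx R) (a z mu : Cplx R) (d s r C M : Cplx R).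
Implicit Types (rs : seq (Cplx R)) (Omega : set (Cplx R)).

Definition thick rs0 s : set (Cplx R) := [set z | exists2 mu, mu \in rs0 & `|z - mu| <= s].

Lemma thick_le rs0 s r : s <= r -> thick rs0 s `<=` thick rs0 r.
Proof. by move=> sr z [mu mu_in zs]; exists mu => //; exact: le_trans zs sr. Qed.

Lemma thick_ball rs0 s d a x : thick rs0 s a -> `|x - a| <= d -> thick rs0 (s + d) x.
Proof.
move=> [mu mu_in amu] xa; exists mu => //.
by rewrite -(subrKA a) addrC (le_trans (ler_normD _ _)) // lerD.
Qed.

(** [B] is chosen before the nodes, the function and the matrix. Each divided difference turns the
    bound [C] into [4 * C / d] and uses up a margin [d] around the nodes, hence the radius
    [s + l%:R * d]. *)
Lemma newton_bound n rs0 d M (l : nat) C : 0 < d -> exists B, forall s g rs (A : 'M[Cplx R]_n),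
  size rs = l -> 0 <= s -> (forall z, thick rs0 (s + l%:R * d) z -> hol g z /\ `|g z| <= C) ->
  (forall a, a \in rs -> thick rs0 s a /\ `|a| <= M) -> mx_bounded M A ->
  mx_bounded B (mxeval A (newton rs g)).
Proof.
move=> d0; elim: l C => [|l IH] C.
  exists 0 => s g [|//] A _ _ _ _ _ i j /=.
  by rewrite mxeval0 mxE normr0.
have [B HB] := IH (4 * C / d).
(* [B] bounds the inner polynomial, [M + M] the factor [A - a], and [C] the constant term [g a]. *)
exists (n%:R * (B * (M + M)) + C) => s g [//|a rs] A [size_rs] s0 gC rsM AM.
have [a_thick aM] := rsM a (mem_head _ _).
have ld0 : 0 <= l%:R * d by rewrite mulr_ge0 ?ler0n ?ltW.
have ldd : l.+1%:R * d = l%:R * d + d by rewrite -natr1 mulrDl mul1r.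
have sub1 : s + d <= s + l.+1%:R * d by rewrite ldd lerD2l lerDr.
have sub2 : s + l%:R * d <= s + l.+1%:R * d by rewrite ldd lerD2l lerDl ltW.
have sub3 : s <= s + l.+1%:R * d by apply: le_trans sub1; rewrite lerDl ltW.
have [ha gaC] := gC a (thick_le sub3 a_thick).
have N_bnd : mx_bounded B (mxeval A (newton rs (divdiff a g))).
  apply: (HB s _ rs A size_rs s0 _ _ AM) => [z zt|b b_rs].
    have [hz gz] := gC z (thick_le sub2 zt); split; first exact: (divdiff_hol ha hz).
    have ball_a x : `|x - a| <= d -> hol g x /\ `|g x| <= C.
      by move=> xa; exact: gC (thick_le sub1 (thick_ball a_thick xa)).
    by apply: (divdiff_bound d0 _ _ gz) => x /ball_a[].
  by apply: rsM; rewrite in_cons b_rs orbT.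
move=> i j; rewrite /= mxevalD mxevalM mxevalC mxE (le_trans (ler_normD _ _)) // lerD //.
  apply: mx_boundedM N_bnd _ i j => i j; rewrite mxevalD mxevalX -polyCN mxevalC mxE.
  rewrite (le_trans (ler_normD _ _)) // lerD //.
  rewrite mxE; case: (i == j); last by rewrite mulr0n normr0; exact: le_trans aM.
  by rewrite mulr1n normrN.
rewrite mxE; case: (i == j); last by rewrite mulr0n normr0; exact: le_trans gaC.
by rewrite mulr1n.
Qed.

Lemma ex_good_radius Omega f rs0 : open Omega -> (forall z, Omega z -> hol f z) ->
  (forall a, a \in rs0 -> Omega a) ->
  exists r, 0 < r /\ exists C, forall z, thick rs0 r z -> Omega z /\ `|f z| <= C.
Proof.
move=> oO hf; elim: rs0 => [|mu rs0 IH] rsO.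
  by exists 1; split=> //; exists 0 => z [].
have [|r1 [r10 [C1 H1]]] := IH; first by move=> a ars; apply: rsO; rewrite in_cons ars orbT.
have Omu : Omega mu by apply: rsO; exact: mem_head.
have near_f : \forall z \near mu, `|f mu - f z| < 1.
  apply: (@cvgr_dist_lt _ _ _ (nbhs mu) _ f) => //.
  exact: hol_continuous (hf _ Omu).
have near_O : \forall z \near mu, Omega z by exact: open_nbhs_nbhs.
have [d d0 dP] := near_dist (filterI near_O near_f).
have d20 : 0 < d / 2 by rewrite divr_gt0.
have [r [r0 le1 le2]] := ex_min_pos r10 d20.
(* If [thick rs0 r1] is empty, nothing forces [C1] to be real or nonnegative; hence its norm. *)
exists r; split=> //; exists (`|C1| + (`|f mu| + 1)) => z [nu].
rewrite in_cons => /orP[/eqP ->|nu_in] z_nu.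
  have /dP[Oz fz] : `|z - mu| < d.
    apply: le_lt_trans z_nu _; apply: le_lt_trans le2 _.
    by rewrite ltr_pdivrMr // ltr_pMr // ltr1n.
  split=> //; apply: ler_wpDl => //.
  rewrite -[f z](subrK (f mu)) addrC (le_trans (ler_normD _ _)) // lerD2l distrC.
  exact: ltW.
have [|Oz fz] := H1 z; first by exists nu => //; exact: le_trans z_nu le1.
split=> //; apply: ler_wpDr; first by rewrite addr_ge0.
have C10 : 0 <= C1 by exact: le_trans fz.
by rewrite (ger0_norm C10).
Qed.

Lemma eigenvalue_norm_le n (P : 'M[Cplx R]_n) c M (v : 'rV[Cplx R]_n) :
  v *m P = c *: v -> v != 0 -> mx_bounded M P -> `|c| <= n%:R * M.
Proof.
move=> vP v0 PM; pose S := \sum_i `|v 0 i|.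
have S0 : 0 < S.
  rewrite lt0r sumr_ge0 // andbT; apply: contraNneq v0 => S0.
  apply/eqP/rowP => i; rewrite mxE; apply/eqP; rewrite -normr_eq0.
  have /psumr_eq0P := S0; rewrite /= => S0'; apply/eqP; exact: S0'.
rewrite -(ler_pM2r S0) {1}/S mulr_sumr.
apply: (@le_trans _ _ (\sum_(i < n) S * M)).
  apply: ler_sum => i _; rewrite -normrM.
  have /rowP/(_ i) := vP; rewrite !mxE => <-.
  rewrite (le_trans (ler_norm_sum _ _ _)) // mulr_suml ler_sum // => k _.
  by rewrite normrM ler_wpM2l // PM.
by rewrite sumr_const card_ord -[(S * M) *+ n]mulr_natl -mulrA [S * M]mulrC.
Qed.

(** With [q] the characteristic polynomial of [A0], Cayley-Hamilton and continuity make [q(A)]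
    small. For an eigenvalue [a] of [A], [q(a)] is an eigenvalue of [q(A)], hence small; but
    [|q(a)| >= s ^+ size rs0] if [a] is at distance at least [s] from all roots. *)
Lemma eigenvalue_near n (A0 : 'M[Cplx R]_n) rs0 s : 0 < s ->
  char_poly A0 = \prod_(a <- rs0) ('X - a%:P) ->
  \forall A \near A0, forall a, eigenvalue A a -> thick rs0 s a.
Proof.
move=> s0 rsE; pose q := char_poly A0.
(* Chosen so that [n%:R * eta < s ^+ size rs0], strictly. *)
pose eta := s ^+ size rs0 / (n%:R + 1).
have n10 : (0 : Cplx R) < n%:R + 1 by rewrite ltr_wpDl.
have eta0 : 0 < eta by rewrite divr_gt0 ?exprn_gt0.
have : \forall A \near A0, forall i j, `|mxeval A q i j| < eta.
  have cq := @continuous_mxeval R n q A0.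
  have near_q : nbhs A0 (fun A : 'M[Cplx R]_n =>
    forall i j, `|mxeval A q i j - mxeval A0 q i j| < eta) :=
    cq _ (near_entries (mxeval A0 q) eta0).
  apply: filterS near_q => A HA i j; have := HA i j.
  by rewrite mxeval_char_poly mxE subr0.
apply: filterS => A HA a /eigenvalueP[v vA v0].
have vq : v *m mxeval A q = q.[a] *: v.
  have := @mxeval_intertwine _ _ _ (a%:M : 'M_1) A v q.
  rewrite mul_scalar_mx -vA => /(_ erefl) <-.
  suff -> : mxeval (a%:M : 'M_1) q = (q.[a])%:M by rewrite mul_scalar_mx.
  elim/poly_ind: (q) => [|p c IH]; first by rewrite mxeval0 horner0 raddf0.
  by rewrite mxeval_MXaddC IH -scalar_mxM -raddfD !hornerE.
have qa : `|q.[a]| <= n%:R * eta.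
  by apply: eigenvalue_norm_le vq v0 _ => i j; exact: ltW.
apply: contrapT => nthick.
have far mu : mu \in rs0 -> s <= `|a - mu|.
  move=> mu_in; have [//|lt] := real_leP (gtr0_real s0) (normr_real (a - mu)).
  by case: nthick; exists mu => //; exact: ltW.
have : s ^+ size rs0 <= `|q.[a]|.
  rewrite /q rsE; elim: (rs0) far => [|mu rs IH] far.
    by rewrite big_nil hornerC normr1.
  rewrite big_cons hornerM hornerXsubC normrM exprS; apply: ler_pM.
  - exact: ltW.
  - by rewrite exprn_ge0 // ltW.
  - exact: far (mem_head _ _).
  - by apply: IH => nu nu_in; apply: far; rewrite in_cons nu_in orbT.
move=> /le_trans/(_ qa); rewrite /eta mulrA ler_pdivlMr // mulrC ler_pM2r ?exprn_gt0 //.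
by rewrite -subr_ge0 opprD addNKr oppr_ge0 ler10.
Qed.

Lemma spectrum_open Omega n (A0 : 'M[Cplx R]_n) : open Omega -> spectrum_in Omega A0 ->
  \forall A \near A0, spectrum_in Omega A.
Proof.
move=> oO AO; have [rs0 [rsE _ rs_eig]] := char_poly_roots A0.
(* Only the radius is wanted, so the zero function serves. *)
have [|r [r0 [C HC]]] := @ex_good_radius Omega (fun=> 0) rs0 oO (fun z _ => hol_cst 0 z).
  by move=> a; rewrite rs_eig; exact: AO.
have := eigenvalue_near r0 rsE; apply: filterS => A HA a /HA /HC; by case.
Qed.

Lemma matfun_locally_bounded Omega f n (A0 : 'M[Cplx R]_n) : open Omega ->
  (forall z, Omega z -> hol f z) -> spectrum_in Omega A0 ->
  exists B, \forall A \near A0, mx_bounded B (matfun f A).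
Proof.
move=> oO hf AO; have [rs0 [rsE _ rs_eig]] := char_poly_roots A0.
have [|r [r0 [C HC]]] := @ex_good_radius Omega f rs0 oO hf.
  by move=> a; rewrite rs_eig; exact: AO.
have n10 : (0 : Cplx R) < n%:R + 1 by rewrite ltr_wpDl.
(* The eigenvalues move by at most [d] and [n] divided differences use up [n%:R * d], which together
   is [r]. *)
pose d := r / (n%:R + 1); have d0 : 0 < d by rewrite divr_gt0.
(* One constant for both needs: the entries of [A] are within 1 of those of [A0], and each node is
   within [d] of some [mu]. *)
pose M0 := \sum_i \sum_j `|A0 i j| + 1 + \sum_(mu <- rs0) `|mu| + d.
have [B HB] := newton_bound n rs0 M0 n C d0.
exists B; apply: filterS2 (eigenvalue_near d0 rsE) (near_entries A0 ltr01) => A eigA nearA.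
have [rs [rsAE size_rs rsA]] := char_poly_roots A.
have rs_thick a : a \in rs -> thick rs0 d a by rewrite rsA; exact: eigA.
have dr : d + n%:R * d = r.
  by rewrite -{1}[d]mul1r -mulrDl addrC /d mulrC divfK // gt_eqF.
have rsO a : a \in rs -> Omega a.
  move=> /rs_thick at_; have [] // := HC a; apply: thick_le at_.
  by rewrite -dr lerDl mulr_ge0 ?ler0n // ltW.
have [|_ ->] := @matfun_newton R Omega f rs n A hf rsO; first by rewrite -rsAE mxeval_char_poly.
have sA0 : 0 <= \sum_i \sum_j `|A0 i j| by apply: sumr_ge0 => i _; exact: sumr_ge0.
have srs0 : 0 <= \sum_(mu <- rs0) `|mu| by exact: sumr_ge0.
apply: (HB d) => // [|z|a a_rs|].
- exact: ltW.
- by rewrite dr => /HC[Oz fz]; split=> //; exact: hf.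
- split; first exact: rs_thick.
  have [mu mu_in a_mu] := rs_thick a a_rs.
  rewrite -(subrK mu a) (le_trans (ler_normD _ _)) // addrC lerD //.
  rewrite ler_wpDl ?addr_ge0 // (big_rem mu) //= lerDl sumr_ge0 //.
- move=> i j; rewrite -(subrK (A0 i j) (A i j)) (le_trans (ler_normD _ _)) //.
  rewrite /M0 -!addrA addrC lerD //.
    by rewrite (le_trans (ltW (nearA i j))) // lerDl addr_ge0 // ltW.
  rewrite (bigD1 i) //= (bigD1 j) //= -addrA lerDl addr_ge0 // sumr_ge0 // => k _.
  exact: sumr_ge0.
Qed.

End Perturbation.

Lemma differential_of_bound (K : numFieldType) (V W : normedModType K) (f : V -> W)
    (psi : {linear V -> W}) (x : V) : continuous psi ->
  (forall e : K, 0 < e -> \forall h \near (0 : V),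
     `|f (h + x) - f x - psi h| <= e * `|h|) ->
  differentiable f x /\ 'd f x = psi :> (V -> W).
Proof.
move=> psi_cont psi_bound.
have psi_o : f \o shift x = cst (f x) + psi +o_ 0 id.
  apply/eqaddoP => e e0; apply: filterS (psi_bound e e0) => h.
  by rewrite -[X in _ -> `|X| <= _]/(f (h + x) - (f x + psi h)) opprD addrA.
have dE := diff_unique psi_cont psi_o.
by split=> //; apply/diff_locallyP; rewrite dE.
Qed.

(** * Block triangular matrices *)

Section BlockMatrixFunction.
Variable R : realType.
Implicit Types (f : Cplx R -> Cplx R) (Omega : set (Cplx R)).

Lemma char_poly_ublock m n (A : 'M[Cplx R]_m) (E : 'M_(m, n)) (B : 'M_n) :
  char_poly (block_mx A E 0 B) = char_poly A * char_poly B.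
Proof.
rewrite /char_poly /char_poly_mx map_block_mx map_mx0 scalar_mx_block.
by rewrite opp_block_mx add_block_mx oppr0 addr0 det_ublock.
Qed.

Lemma spectrum_ublock Omega m n (A : 'M[Cplx R]_m) (E : 'M_(m, n)) (B : 'M_n) :
  spectrum_in Omega A -> spectrum_in Omega B -> spectrum_in Omega (block_mx A E 0 B).
Proof.
move=> AO BO a; rewrite eigenvalue_root_char char_poly_ublock rootM -!eigenvalue_root_char.
by move=> /orP[/AO|/BO].
Qed.

(** For [p X + c] the corner becomes [p(A) E + psi E B], so linearity in [E] is carried along the
    induction as a bundled map. *)
Lemma mxeval_ublock m n (A : 'M[Cplx R]_m) (B : 'M[Cplx R]_n) p :
  exists psi : {linear 'M[Cplx R]_(m, n) -> 'M[Cplx R]_(m, n)}, forall E,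
    mxeval (block_mx A E 0 B) p = block_mx (mxeval A p) (psi E) 0 (mxeval B p).
Proof.
elim/poly_ind: p => [|p c [psi IH]].
  exists (\0 : {linear 'M[Cplx R]_(m, n) -> 'M[Cplx R]_(m, n)}) => E.
  by rewrite !mxeval0 -block_mx0.
exists (mulmx (mxeval A p) \+ (mulmxr B \o psi)) => E.
rewrite !mxeval_MXaddC IH mulmx_block !mulmx0 !mul0mx !add0r !addr0.
by rewrite scalar_mx_block add_block_mx !addr0.
Qed.

(** The column [(- X, 1)] intertwines [[[A, A X - X B], [0, B]]] with [B]. Applying the common
    Newton polynomial and reading the upper component gives the second claim. *)
Lemma matfun_ublock Omega f m n (A : 'M[Cplx R]_m) (B : 'M[Cplx R]_n) :
  (forall z, Omega z -> hol f z) -> spectrum_in Omega A -> spectrum_in Omega B ->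
  exists psi : {linear 'M[Cplx R]_(m, n) -> 'M[Cplx R]_(m, n)},
    (forall E, matfun f (block_mx A E 0 B) = block_mx (matfun f A) (psi E) 0 (matfun f B)) /\
    (forall X, psi (A *m X - X *m B) = matfun f A *m X - X *m matfun f B).
Proof.
move=> hf AO BO; have [rs [rsE _ rs_eig]] := char_poly_roots (block_mx A 0 0 B).
have rsO a : a \in rs -> Omega a by rewrite rs_eig; exact: spectrum_ublock.
have qE : \prod_(a <- rs) ('X - a%:P) = char_poly A * char_poly B.
  by rewrite -rsE char_poly_ublock.
have fE k (M : 'M[Cplx R]_k) : mxeval M (char_poly A * char_poly B) = 0 ->
    matfun f M = mxeval M (newton rs f).
  by rewrite -qE => /(matfun_newton hf rsO)[].
have fA : matfun f A = mxeval A (newton rs f).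
  by apply: fE; rewrite mxevalM mxeval_char_poly mul0mx.
have fB : matfun f B = mxeval B (newton rs f).
  by apply: fE; rewrite mxevalM mxeval_char_poly mulmx0.
have [psi psiE] := mxeval_ublock A B (newton rs f).
exists psi; split=> [E|X].
  rewrite fE ?psiE ?fA ?fB // -(char_poly_ublock A E B); exact: mxeval_char_poly.
have := @mxeval_intertwine _ _ _ (block_mx A (A *m X - X *m B) 0 B) B (col_mx (- X) 1%:M)
  (newton rs f).
rewrite psiE !mul_block_col !mul_col_mx !mul0mx !add0r !mulmx1 !mul1mx.
rewrite !mulmxN !mulNmx addKr => /(_ erefl) /eq_col_mx[+ _].
rewrite -fA -fB => /eqP; rewrite addrC subr_eq => /eqP ->.
by rewrite addrC.
Qed.

(** The case [X = 1] of the block identity, an exact increment formula. Expanding [B - A] in unit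
    matrices puts the small quantities into scalars and leaves corners that depend on the increment
    only through [B]. *)
Lemma matfun_sub Omega f n (A B : 'M[Cplx R]_n) :
  (forall z, Omega z -> hol f z) -> spectrum_in Omega A -> spectrum_in Omega B ->
  matfun f B - matfun f A = \sum_i \sum_j
    (B i j - A i j) *: ursubmx (matfun f (block_mx B (delta_mx i j) 0 A)).
Proof.
move=> hf AO BO; have [psi [psiE psi_sub]] := matfun_ublock hf BO AO.
have := psi_sub 1%:M; rewrite !mulmx1 !mul1mx => <-.
rewrite {1}(matrix_sum_delta (B - A)) linear_sum; apply: eq_bigr => i _.
rewrite linear_sum; apply: eq_bigr => j _.
by rewrite linearZ /= psiE block_mxKur !mxE.
Qed.

Lemma ursubmx_matfun Omega f n (A E : 'M[Cplx R]_n) :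
  (forall z, Omega z -> hol f z) -> spectrum_in Omega A ->
  ursubmx (matfun f (block_mx A E 0 A)) = \sum_i \sum_j
    E i j *: ursubmx (matfun f (block_mx A (delta_mx i j) 0 A)).
Proof.
move=> hf AO; have [psi [psiE _]] := matfun_ublock hf AO AO.
rewrite psiE block_mxKur {1}(matrix_sum_delta E) linear_sum; apply: eq_bigr => i _.
rewrite linear_sum; apply: eq_bigr => j _.
by rewrite linearZ /= psiE block_mxKur.
Qed.

Lemma continuous_block_mx (T : topologicalType) m1 m2 n1 n2
    (A : T -> 'M[Cplx R]_(m1, n1)) (B : T -> 'M[Cplx R]_(m1, n2))
    (C : T -> 'M[Cplx R]_(m2, n1)) (D : T -> 'M[Cplx R]_(m2, n2)) (x : T) :
  {for x, continuous A} -> {for x, continuous B} ->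
  {for x, continuous C} -> {for x, continuous D} ->
  {for x, continuous (fun t => block_mx (A t) (B t) (C t) (D t))}.
Proof.
move=> cA cB cC cD; apply: continuous_mx => i j.
case: (split_ordP i) => i' ->; case: (split_ordP j) => j' ->.
- rewrite (_ : (fun t => _) = (fun t => A t i' j')); last by apply: funext => t; rewrite block_mxEul.
  exact: (@continuous_entry _ _ _ _ A x i' j' cA).
- rewrite (_ : (fun t => _) = (fun t => B t i' j')); last by apply: funext => t; rewrite block_mxEur.
  exact: (@continuous_entry _ _ _ _ B x i' j' cB).
- rewrite (_ : (fun t => _) = (fun t => C t i' j')); last by apply: funext => t; rewrite block_mxEdl.
  exact: (@continuous_entry _ _ _ _ C x i' j' cC).
- rewrite (_ : (fun t => _) = (fun t => D t i' j')); last by apply: funext => t; rewrite block_mxEdr.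
  exact: (@continuous_entry _ _ _ _ D x i' j' cD).
Qed.

Lemma continuous_ursubmx (T : topologicalType) m1 m2 n1 n2
    (A : T -> 'M[Cplx R]_(m1 + m2, n1 + n2)) (x : T) :
  {for x, continuous A} -> {for x, continuous (fun t => ursubmx (A t))}.
Proof.
move=> cA; apply: continuous_mx => i j.
rewrite (_ : (fun t => _) = (fun t => A t (lshift m2 i) (rshift n1 j))); last first.
  by apply: funext => t; rewrite !mxE.
exact: (@continuous_entry _ _ _ _ A x _ _ cA).
Qed.

Lemma norm_double_sum_le n (b g : 'I_n -> 'I_n -> Cplx R) (e M : Cplx R) :
  (forall i j, `|b i j| <= e) -> (forall i j, `|g i j| <= M) ->
  `|\sum_i \sum_j b i j * g i j| <= (n * n)%:R * (e * M).
Proof.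
move=> be gM; apply: le_trans (ler_norm_sum _ _ _) _.
apply: le_trans (ler_sum _ (G := fun=> n%:R * (e * M)) _) _; last first.
  by rewrite sumr_const card_ord -[(n%:R * _) *+ n]mulr_natl mulrA -natrM.
move=> i _; apply: le_trans (ler_norm_sum _ _ _) _.
apply: le_trans (ler_sum _ (G := fun=> e * M) _) _; last first.
  by rewrite sumr_const card_ord -[(e * M) *+ n]mulr_natl.
by move=> j _; rewrite normrM ler_pM.
Qed.

Lemma linear_mx_continuous m n p q
    (psi : {linear 'M[Cplx R]_(m, n) -> 'M[Cplx R]_(p, q)}) : continuous psi.
Proof.
move=> E; apply: continuous_mx => k l.
rewrite (_ : (fun E : 'M[Cplx R]_(m, n) => _) =
  (fun E : 'M[Cplx R]_(m, n) => \sum_i \sum_j E i j * psi (delta_mx i j) k l)).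
  apply: continuous_sum => i; apply: continuous_sum => j.
  have cE : {for E, continuous (fun E : 'M[Cplx R]_(m, n) => E i j)} by exact: coord_continuous.
  exact: (cvgM cE (@cvg_cst _ (psi (delta_mx i j) k l) _ (nbhs E) _)).
apply: funext => F; rewrite {1}(matrix_sum_delta F) linear_sum summxE.
apply: eq_bigr => i _; rewrite linear_sum summxE; apply: eq_bigr => j _.
by rewrite linearZ mxE.
Qed.

Lemma near_forall_mx (I : finType) n (A : 'M[Cplx R]_n) (P : I -> 'M[Cplx R]_n -> Prop) :
  (forall i, nbhs A (P i)) -> nbhs A (fun B => forall i, P i B).
Proof. by move=> AP; exact: (@filter_forall _ I P (nbhs A) (nbhs_filter A) AP). Qed.

Lemma near_dist_mx n (A : 'M[Cplx R]_n) (P : 'M[Cplx R]_n -> Prop) : nbhs A P ->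
  exists2 d : Cplx R, 0 < d & forall B, `|B - A| < d -> P B.
Proof. by move=> AP; exact: (near_distP A P).1. Qed.

Lemma continuous_near_dist (T : topologicalType) (g : T -> Cplx R) (x : T) :
  (forall e : Cplx R, 0 < e -> nbhs x (fun t => `|g x - g t| < e)) ->
  {for x, continuous g}.
Proof. by move=> gx; apply/cvgrPdist_lt => e /gx. Qed.

(** * Continuity and first derivative of a matrix function *)

Section Smoothness.
Variables (Omega : set (Cplx R)) (f : Cplx R -> Cplx R).
Hypothesis oO : open Omega.
Hypothesis hf : forall z, Omega z -> hol f z.

Lemma matfun_continuous n (A : 'M[Cplx R]_n) : spectrum_in Omega A ->
  {for A, continuous (matfun f : 'M[Cplx R]_n -> 'M[Cplx R]_n)}.
Proof.
move=> AO.
pose G (i j : 'I_n) (B : 'M[Cplx R]_n) : 'M[Cplx R]_n := ursubmx (matfun f (block_mx B (delta_mx i j) 0 A)).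
have Gb (ij : 'I_n * 'I_n) : exists M, \forall B \near A, mx_bounded M (G ij.1 ij.2 B).
  have [M HM] := matfun_locally_bounded oO hf (@spectrum_ublock Omega n n A (delta_mx ij.1 ij.2) A AO AO).
  exists M; have cb : {for A, continuous (fun B : 'M[Cplx R]_n => block_mx B (delta_mx ij.1 ij.2) 0 A)}.
    apply: continuous_block_mx; first exact: cvg_id.
    - exact: (@cvg_cst _ (delta_mx ij.1 ij.2 : 'M[Cplx R]_n) _ (nbhs A) _).
    - exact: (@cvg_cst _ (0 : 'M[Cplx R]_n) _ (nbhs A) _).
    - exact: (@cvg_cst _ A _ (nbhs A) _).
  have near_b : nbhs A (fun B : 'M[Cplx R]_n =>
    mx_bounded M (matfun f (block_mx B (delta_mx ij.1 ij.2) 0 A))) := cb _ HM.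
  by apply: filterS near_b => B HB k l; rewrite !mxE.
have [M HM] := choice Gb.
pose S := \sum_(ij : 'I_n * 'I_n) `|M ij|; have S0 : 0 <= S by exact: sumr_ge0.
have near_G : \forall B \near A, forall ij : 'I_n * 'I_n, mx_bounded S (G ij.1 ij.2 B).
  apply: near_forall_mx => ij.
  apply: filterS (HM ij) => B HB k l.
  apply: le_trans (HB k l) _; have Mij0 : 0 <= M ij by exact: le_trans (HB k l).
  by rewrite /S (bigD1 ij) //= (ger0_norm Mij0) lerDl sumr_ge0.
apply: continuous_mx => k l; apply: continuous_near_dist => e e0.
pose c := (n * n)%:R * S + 1; have c0 : 0 < c by rewrite ltr_wpDl // mulr_ge0.
have ec0 : 0 < e / c by rewrite divr_gt0.
apply: filterS3 near_G (near_entries A ec0) (spectrum_open oO AO) => B GB AB BO.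
rewrite distrC -[matfun f B k l - _](_ : (matfun f B - matfun f A) k l = _); last first.
  by rewrite !mxE.
rewrite (matfun_sub hf AO BO) summxE.
under eq_bigr do rewrite summxE.
under eq_bigr do under eq_bigr do rewrite mxE.
apply: le_lt_trans (norm_double_sum_le (e := e / c) (M := S) _ _) _.
- by move=> i j; exact: ltW.
- by move=> i j; exact: (GB (i, j)).
rewrite [ltLHS](_ : _ = e * ((n * n)%:R * S) / c); last by ring.
by rewrite ltr_pdivrMr // ltr_pM2l // /c ltrDl ltr01.
Qed.

Lemma matfun_first_order n (A : 'M[Cplx R]_n) : spectrum_in Omega A ->
  exists psi : {linear 'M[Cplx R]_n -> 'M[Cplx R]_n},
    (forall E, psi E = ursubmx (matfun f (block_mx A E 0 A))) /\
    forall e : Cplx R, 0 < e -> \forall h \near (0 : 'M[Cplx R]_n),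
      `|matfun f (h + A) - matfun f A - psi h| <= e * `|h|.
Proof.
move=> AO; have [psi [psiE _]] := matfun_ublock hf AO AO.
have psiK E : psi E = ursubmx (matfun f (block_mx A E 0 A)) by rewrite psiE block_mxKur.
pose G (i j : 'I_n) (B : 'M[Cplx R]_n) : 'M[Cplx R]_n := ursubmx (matfun f (block_mx B (delta_mx i j) 0 A)).
have cG i j : {for A, continuous (G i j)}.
  apply: continuous_ursubmx.
  have cb : {for A, continuous (fun B : 'M[Cplx R]_n => block_mx B (delta_mx i j) 0 A)}.
    apply: continuous_block_mx; first exact: cvg_id.
    - exact: (@cvg_cst _ (delta_mx i j : 'M[Cplx R]_n) _ (nbhs A) _).
    - exact: (@cvg_cst _ (0 : 'M[Cplx R]_n) _ (nbhs A) _).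
    - exact: (@cvg_cst _ A _ (nbhs A) _).
  have cm := matfun_continuous (@spectrum_ublock Omega n n A (delta_mx i j) A AO AO).
  exact: (@continuous_comp _ _ _ (fun B : 'M[Cplx R]_n => block_mx B (delta_mx i j) 0 A)
    (matfun f) A cb cm).
exists psi; split=> // e e0.
  pose c : Cplx R := (n * n)%:R + 1; have c0 : 0 < c by rewrite ltr_wpDl.
  have ec0 : 0 < e / c by rewrite divr_gt0.
  have near_G : \forall B \near A, forall ij : 'I_n * 'I_n, forall k l,
      `|G ij.1 ij.2 B k l - G ij.1 ij.2 A k l| < e / c.
    apply: near_forall_mx => ij.
    exact: (cG ij.1 ij.2 _ (near_entries (G ij.1 ij.2 A) ec0)).
  have [d d0 dP] := near_dist_mx (filterI near_G (spectrum_open oO AO)).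
  apply/near_distP; exists d => // h; rewrite subr0 => hd.
  have [|GB BO] := dP (h + A); first by rewrite addrK.
  apply: norm_le_entries; first by rewrite mulr_ge0 // ltW.
  move=> k l; rewrite (matfun_sub hf AO BO) psiK (ursubmx_matfun h hf AO).
  (* Increment and linear part expand over the same unit matrices, so the remainder pairs each entry
     of [h] with an increment of a continuous corner, which is below [e / c]. *)
  rewrite [X in `|X|](_ : _ = \sum_i \sum_j h i j * (G i j (h + A) k l - G i j A k l)).
    apply: le_trans (norm_double_sum_le (e := `|h|) (M := e / c) _ _) _.
    - by move=> i j; exact: entry_le_norm.
    - by move=> i j; exact: ltW (GB (i, j) k l).
    rewrite mulrCA mulrC ler_wpM2r // mulrCA ler_piMr ?(ltW e0) //.
    by rewrite ler_pdivrMr // mul1r lerDl.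
  rewrite -sumrB summxE; apply: eq_bigr => i _.
  rewrite -sumrB summxE; apply: eq_bigr => j _.
  rewrite [(h + A) i j]mxE addrK -scalerBr mxE; congr (_ * _).
  by rewrite mxE [X in _ + X]mxE.
Qed.

End Smoothness.

End BlockMatrixFunction.

(** * Higher derivatives *)

Section FrechetDerivative.
Variable R : realType.
Implicit Types (f : Cplx R -> Cplx R) (Omega : set (Cplx R)).

(* I_(2^i) (x) E *)
Fixpoint diag_block n (i : nat) (E : 'M[Cplx R]_n) : 'M[Cplx R]_(block_dim n i) :=
  if i is j.+1 then block_mx (diag_block j E) 0 0 (diag_block j E) else E.

(* X_i at a point where A(x) = A. *)
Fixpoint block_B n (i : nat) (A : 'M[Cplx R]_n) :
    ('I_i -> 'M[Cplx R]_n) -> 'M[Cplx R]_(block_dim n i) :=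
  match i with
  | 0 => fun _ => A
  | j.+1 => fun E =>
      let X := block_B A (fun l : 'I_j => E (widen_ord (leqnSn j) l)) in
      block_mx X (diag_block j (E ord_max)) 0 X
  end.

(** Moving [A] by [H] adds [diag_block i H], the very block placed in the corner at the next level;
    differentiating therefore reproduces [block_B]. *)
Lemma block_BD n i (A H : 'M[Cplx R]_n) (E : 'I_i -> 'M[Cplx R]_n) :
  block_B (H + A) E = diag_block i H + block_B A E.
Proof.
elim: i E => [|i IH] E //=.
by rewrite IH add_block_mx !add0r.
Qed.

Lemma diag_blockZ n i (c : Cplx R) (E : 'M[Cplx R]_n) :
  diag_block i (c *: E) = c *: diag_block i E.
Proof. by elim: i => [|i IH] //=; rewrite IH scale_block_mx !scaler0. Qed.

Lemma diag_blockD n i (E F : 'M[Cplx R]_n) :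
  diag_block i (E + F) = diag_block i E + diag_block i F.
Proof. by elim: i => [|i IH] //=; rewrite IH add_block_mx !addr0. Qed.

Lemma spectrum_block_B Omega n i (A : 'M[Cplx R]_n) (E : 'I_i -> 'M[Cplx R]_n) :
  spectrum_in Omega A -> spectrum_in Omega (block_B A E).
Proof. by move=> AO; elim: i E => [|i IH] E //=; exact: spectrum_ublock. Qed.

Lemma diag_block_continuous n i (T : topologicalType) (F : T -> 'M[Cplx R]_n) (x : T) :
  {for x, continuous F} -> {for x, continuous (fun t => diag_block i (F t))}.
Proof.
move=> cF; elim: i => [|i IH]; first exact: cF.
have c0 : {for x, continuous (fun _ : T => 0 : 'M[Cplx R]_(block_dim n i))} by exact: cvg_cst.
exact: (continuous_block_mx IH c0 c0 IH).
Qed.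

Lemma block_B_continuous n i (T : topologicalType) (A : T -> 'M[Cplx R]_n)
    (E : T -> 'I_i -> 'M[Cplx R]_n) (x : T) :
  {for x, continuous A} -> (forall l, {for x, continuous (fun t => E t l)}) ->
  {for x, continuous (fun t => block_B (A t) (E t))}.
Proof.
move=> cA; elim: i E => [|i IH] E cE; first exact: cA.
have cB := IH (fun t l => E t (widen_ord (leqnSn i) l)) (fun l => cE (widen_ord (leqnSn i) l)).
have cD := @diag_block_continuous n i T (fun t => E t ord_max) x (cE ord_max).
have c0 : {for x, continuous (fun _ : T => 0 : 'M[Cplx R]_(block_dim n i))} by exact: cvg_cst.
exact: (continuous_block_mx cB cD c0 cB).
Qed.

Lemma upper_right_continuous n i (T : topologicalType)
    (F : T -> 'M[Cplx R]_(block_dim n i)) (x : T) :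
  {for x, continuous F} -> {for x, continuous (fun t => upper_right n i (F t))}.
Proof.
elim: i F => [|i IH] F cF; first exact: cF.
exact: (IH _ (continuous_ursubmx cF)).
Qed.

Lemma upper_rightD n i (X Y : 'M[Cplx R]_(block_dim n i)) :
  upper_right n i (X + Y) = upper_right n i X + upper_right n i Y.
Proof.
elim: i X Y => [|i IH] X Y //=; rewrite -IH; congr upper_right.
by apply/matrixP => k l; rewrite !mxE.
Qed.

Lemma upper_rightZ n i c (X : 'M[Cplx R]_(block_dim n i)) :
  upper_right n i (c *: X) = c *: upper_right n i X.
Proof.
elim: i X => [|i IH] X //=; rewrite -IH; congr upper_right.
by apply/matrixP => k l; rewrite !mxE.
Qed.

Lemma upper_rightB n i (X Y : 'M[Cplx R]_(block_dim n i)) :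
  upper_right n i (X - Y) = upper_right n i X - upper_right n i Y.
Proof. by rewrite upper_rightD -scaleN1r upper_rightZ scaleN1r. Qed.

Lemma diag_block_norm n i (E : 'M[Cplx R]_n) : `|diag_block i E| <= `|E|.
Proof.
elim: i => [|i IH] //=; apply: norm_le_entries => [|k l]; first exact: normr_ge0.
case: (split_ordP k) => k' ->; case: (split_ordP l) => l' ->.
- by rewrite block_mxEul; apply: le_trans IH; exact: entry_le_norm.
- by rewrite block_mxEur mxE normr0.
- by rewrite block_mxEdl mxE normr0.
- by rewrite block_mxEdr; apply: le_trans IH; exact: entry_le_norm.
Qed.

Lemma upper_right_norm n i (X : 'M[Cplx R]_(block_dim n i)) :
  `|upper_right n i X| <= `|X|.
Proof.
elim: i X => [|i IH] X //=; apply: le_trans (IH _) _.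
apply: norm_le_entries => [|k l]; first exact: normr_ge0.
by rewrite !mxE; exact: entry_le_norm.
Qed.

Lemma differentiable_near_eq (V W : normedModType (Cplx R)) (f g : V -> W) (x : V) :
  (\forall y \near x, f y = g y) -> differentiable f x ->
  differentiable g x /\ 'd g x = 'd f x :> (V -> W).
Proof.
move=> fg df; have [cdf dfo] := (diff_locallyP x f).1 df.
apply: differential_of_bound cdf _ => e e0.
have /eqaddoP/(_ e e0) := dfo.
have [d d0 dP] := (near_distP x (fun y => f y = g y)).1 fg.
have near_d : \forall h \near (0 : V), `|h| < d.
  by apply/near_distP; exists d => // h; rewrite subr0.
apply: filterS2 near_d => h hd.
rewrite -[X in `|X| <= _ -> _]/(f (h + x) - (f x + 'd f x h)) opprD addrA.
by rewrite (dP (h + x)) ?addrK // (dP x) // subrr normr0.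
Qed.

Section HolomorphicFunction.
Variables (Omega : set (Cplx R)) (f : Cplx R -> Cplx R) (n : nat).
Hypothesis oO : open Omega.
Hypothesis hf : forall z, Omega z -> hol f z.

(** The chain rule for a linear map after [matfun] after an affine map: the first-order remainder
    carries over directly because neither [diag_block] nor [upper_right] increases the norm. *)
Lemma matfun_block_differential i (E : 'I_i -> 'M[Cplx R]_n) (A : 'M[Cplx R]_n) :
  spectrum_in Omega A ->
  let g := (fun B : 'M[Cplx R]_n => upper_right n i (matfun f (block_B B E))) in
  differentiable g A /\ forall H, 'd g A H = upper_right n i
    (ursubmx (matfun f (block_mx (block_B A E) (diag_block i H) 0 (block_B A E)))).
Proof.
move=> AO g; have BO := @spectrum_block_B Omega n i A E AO.
have [psi [psiE psi_bound]] := matfun_first_order oO hf BO.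
pose u (H : 'M[Cplx R]_n) := upper_right n i (psi (diag_block i H)).
have u_lin : linear u.
  move=> c H K; rewrite /u diag_blockD diag_blockZ linearD linearZ.
  by rewrite upper_rightD upper_rightZ.
pose uM := GRing.isLinear.Build _ _ _ _ _ u_lin.
pose uL : {linear 'M[Cplx R]_n -> 'M[Cplx R]_n} := HB.pack u uM.
have [dg dgE] : differentiable g A /\ 'd g A = uL :> ('M[Cplx R]_n -> 'M[Cplx R]_n).
  apply: differential_of_bound; first exact: linear_mx_continuous.
  move=> e e0; have [d d0 dP] := near_dist_mx (psi_bound e e0).
  apply/near_distP; exists d => // h; rewrite subr0 => hd.
  have hd' : `|diag_block i h| < d by exact: le_lt_trans (diag_block_norm i h) hd.
  have := dP (diag_block i h); rewrite subr0 => /(_ hd') bnd.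
  have -> : g (h + A) - g A - uL h = upper_right n i
      (matfun f (diag_block i h + block_B A E) - matfun f (block_B A E) - psi (diag_block i h)).
    rewrite [RHS]upper_rightB [X in _ = X - _]upper_rightB /g block_BD.
    exact: erefl.
  apply: le_trans (upper_right_norm _) _; apply: le_trans bnd _.
  by rewrite ler_wpM2l ?(ltW e0) // diag_block_norm.
split; first exact: dg.
by move=> H; rewrite dgE -psiE.
Qed.

(** The induction ranges over all [A] because differentiating needs the formula on a neighbourhood.
    The block matrix in the differential is [block_B] at level [i.+1] by definition, so the step
    closes by conversion. *)
Lemma frechetE i (A : 'M[Cplx R]_n) : spectrum_in Omega A ->
  frechet_exists f i A /\ forall E : 'I_i -> 'M[Cplx R]_n,
    frechet f i A E = upper_right n i (matfun f (block_B A E)).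
Proof.
elim: i A => [|i IH] A AO.
  split; first exact: matfun_defined_spectrum hf AO.
  by move=> E.
have near_spec := spectrum_open oO AO.
have dE (E : 'I_i -> 'M[Cplx R]_n) :
    differentiable (fun B : 'M[Cplx R]_n => frechet f i B E) A /\
    forall H, 'd (fun B : 'M[Cplx R]_n => frechet f i B E) A H = upper_right n i
      (ursubmx (matfun f (block_mx (block_B A E) (diag_block i H) 0 (block_B A E)))).
  have [dg dgE] := matfun_block_differential E AO.
  have near_g : \forall B \near A,
      upper_right n i (matfun f (block_B (B : 'M[Cplx R]_n) E)) = frechet f i B E.
    by apply: filterS near_spec => B /IH[_ ->].
  have [dfr dfrE] := differentiable_near_eq near_g dg.
  split; first exact: dfr.
  by move=> H; rewrite dfrE; exact: dgE.
split=> [|E].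
  split; first by apply: filterS near_spec => B /IH[].
  by move=> E; have [] := dE E.
by have [_] := dE (fun l : 'I_i => E (widen_ord (leqnSn i) l)); apply.
Qed.

Lemma frechet_continuous k (A : 'M[Cplx R]_n) (E : 'I_k -> 'M[Cplx R]_n) :
  spectrum_in Omega A ->
  {for (A, E), continuous (fun p : 'M[Cplx R]_n * {ptws 'I_k -> 'M[Cplx R]_n} =>
     frechet f k p.1 p.2)}.
Proof.
move=> AO; pose T := ('M[Cplx R]_n * {ptws 'I_k -> 'M[Cplx R]_n})%type.
have c1 : {for ((A, E) : T), continuous (fun p : T => p.1)} by exact: cvg_fst.
have c2 l : {for ((A, E) : T), continuous (fun p : T => p.2 l)}.
  have cs : {for ((A, E) : T), continuous (fun p : T => p.2)} by exact: cvg_snd.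
  apply: (@continuous_comp _ _ _ (fun p : T => p.2)
    (fun g : {ptws 'I_k -> 'M[Cplx R]_n} => g l) _ cs).
  exact: proj_continuous.
have cB := block_B_continuous c1 c2.
have cf := matfun_continuous oO hf (@spectrum_block_B Omega n k A E AO).
have cfB := @continuous_comp _ _ _ (fun p : T => block_B p.1 p.2) (matfun f) (A, E) cB cf.
have cU := upper_right_continuous cfB.
(* The corner formula holds where the spectrum stays in [Omega], a condition on the first component
   alone. *)
have near_spec : nbhs ((A, E) : T) (fun p : T => spectrum_in Omega p.1).
  exists ([set B : 'M[Cplx R]_n | spectrum_in Omega B], setT).
    by split; [exact: spectrum_open oO AO | exact: filterT].
  by move=> [B F] [].
move=> P; have [_ FE] := frechetE k AO; rewrite /= FE => /cU.
apply: filterS2 near_spec => p /(frechetE k)[_ FEp].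
rewrite /preimage /=.
have -> : frechet f k p.1 p.2 = upper_right n k (matfun f (block_B p.1 p.2)) by exact: FEp.
by [].
Qed.

End HolomorphicFunction.

End FrechetDerivative.

(** * The matrices [X_i(x)] along the affine pencil *)

Section BlockX.
Variables (R : realType) (k n : nat) (A0 : 'M[Cplx R]_n) (E : 'I_k -> 'M[Cplx R]_n).

Lemma affine_pencil0 : affine_pencil A0 E 0 = A0.
Proof.
rewrite /affine_pencil big1 ?addr0 // => i _.
by rewrite mxE /cplx_of_real (_ : (0%:C)%C = 0) // scale0r.
Qed.

Lemma affine_pencil_shift (x : 'rV[R]_k) (i : 'I_k) (t : R) :
  affine_pencil A0 E (t *: (\row_l (l == i :> nat)%:R) + x) =
  cplx_of_real t *: E i + affine_pencil A0 E x.
Proof.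
rewrite /affine_pencil addrCA; congr (_ + _).
rewrite (bigD1 i) //= [in RHS](bigD1 i) //= addrA; congr (_ + _).
  by rewrite !mxE eqxx mulr1 -scalerDl; congr (_ *: _); exact: (rmorphD (real_complex R)).
by apply: eq_bigr => l; rewrite -val_eqE /= => /negPf li; rewrite !mxE li mulr0 add0r.
Qed.

Definition directions i (le_ik : (i <= k)%N) (l : 'I_i) := E (widen_ord le_ik l).

(** The matrix is affine in [x], so the difference quotient is constant for [t != 0], and the limit
    is over the punctured neighbourhood. *)
Lemma partial_block_B i (le_ik : (i <= k)%N) (j : 'I_k) (x : 'rV[R]_k) :
  partial j (fun y => block_B (affine_pencil A0 E y) (directions le_ik)) x =
  diag_block i (E j).
Proof.
rewrite /partial; apply: cvg_lim; first exact: norm_hausdorff.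
have cE : (fun _ : R => diag_block i (E j)) @ (0 : R)^' --> diag_block i (E j).
  exact: cvg_cst.
move=> P /cE; rewrite /= => NP.
have neq0 : \forall t \near (0 : R)^', t != 0 by exact: nbhs_dnbhs_neq.
apply: filterS2 neq0 NP => t t0 /=.
rewrite affine_pencil_shift block_BD addrK diag_blockZ scalerA.
have -> : cplx_of_real t^-1 * cplx_of_real t = 1.
  by rewrite -cplxM mulVf // /cplx_of_real; exact: (rmorph1 (real_complex R)).
by rewrite scale1r.
Qed.

Lemma block_XE i (le_ik : (i <= k)%N) x :
  block_X (affine_pencil A0 E) i x = block_B (affine_pencil A0 E x) (directions le_ik).
Proof.
elim: i le_ik x => [|i IH] lt_ik x //=.
have XE : block_X (affine_pencil A0 E) i =
    (fun y => block_B (affine_pencil A0 E y) (directions (ltnW lt_ik))).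
  by apply: funext => y; exact: IH.
rewrite XE (partial_block_B (ltnW lt_ik) (Ordinal lt_ik)).
have dE : directions (ltnW lt_ik) = fun l => directions lt_ik (widen_ord (leqnSn i) l).
  by apply: funext => l; rewrite /directions; congr E; exact: val_inj.
rewrite dE; congr (block_mx _ (diag_block i _) _ _).
by rewrite /directions; congr E; exact: val_inj.
Qed.

End BlockX.

Lemma times_cont_diff_hol (R : realType) (N : nat) (f : Cplx R -> Cplx R) Omega :
  (0 < N)%N -> open Omega -> times_cont_diff_on N f Omega ->
  forall z, Omega z -> hol f z.
Proof.
move=> N0 oO [df cf] z Oz.
have near_O : \forall w \near z, Omega w by exact: open_nbhs_nbhs.
apply: (@hol_intro _ _ (kderive f)); apply: filterS near_O => w Ow.
  by apply: derivable_is_derive; exact: (df 0%N w N0 Ow).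
(* For [N = 1] continuity of the derivative is assumed; for larger [N] the derivative is itself
   derivable. *)
case: N N0 df cf => [|[|N]] // _ df cf; first exact: (cf w Ow).
exact: (derivable_continuous (df 1%N w isT Ow)).
Qed.

Theorem theorem3p1 (R : realType) (k n m : nat)
    (Omega : set (Cplx R)) (f : Cplx R -> Cplx R)
    (A0 : 'M[Cplx R]_n) (E : 'I_k -> 'M[Cplx R]_n) :
  (0 < k)%N -> (0 < n)%N -> (0 < m)%N ->
  open Omega ->
  (\forall x \near (0 : 'rV[R]_k),
     spectrum_block_in Omega m (affine_pencil A0 E x)) ->
  times_cont_diff_on (k.+1 * m - 1) f Omega ->
  [/\ \forall A \near A0, frechet_exists f k A,
      {for (A0, E), continuous
         (fun p : 'M[Cplx R]_n * {ptws 'I_k -> 'M[Cplx R]_n} =>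
            frechet f k p.1 p.2)},
      matfun_defined f (block_X (affine_pencil A0 E) k 0) &
      frechet f k A0 E =
        upper_right n k (matfun f (block_X (affine_pencil A0 E) k 0))].
Proof.
move=> k0 _ m0 oO specA f_diff.
(* [k >= 1] and [m >= 1] give [k.+1 * m >= 2]: at least one continuous derivative is available. *)
have N0 : (0 < k.+1 * m - 1)%N.
  by rewrite subn_gt0; apply: leq_trans (leq_pmulr k.+1 m0); rewrite ltnS.
have hf := times_cont_diff_hol N0 oO f_diff.
have AO : spectrum_in Omega A0.
  by have [] := nbhs_singleton specA; rewrite affine_pencil0.
have dirE : directions E (leqnn k) = E.
  by apply: funext => l; rewrite /directions; congr E; exact: val_inj.
have XE : block_X (affine_pencil A0 E) k 0 = block_B A0 E.
  by rewrite (block_XE A0 E (leqnn k)) affine_pencil0 dirE.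
have [_ FE] := frechetE oO hf k AO.
rewrite XE; split.
- apply: filterS (spectrum_open oO AO) => A /(frechetE oO hf k)[FA _].
  exact: FA.
- refine (@frechet_continuous R Omega f n oO hf k A0 E AO).
- exact: (matfun_defined_spectrum hf (@spectrum_block_B R Omega n k A0 E AO)).
- exact: FE.
Qed.
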